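(* Let $\lambda(N)$ be a sequence of signatures, $\lambda(N)$ of size $N$, and let $f:[0,1]\to\mathbb R$ be a weakly decreasing function. Suppose that $f$ is piecewise-continuous, $R_\infty(\lambda(N),f)$ is bounded, and $R_1(\lambda(N),f)/N$ tends to zero as $N\to\infty$. Let $y\in\mathbb R\setminus\{0\}$ and let $w_0=w_0(y)$ be the (unique) real root of $$\int_0^1\frac{dt}{w-\widehat f(t)}=y$$ lying in $(\widehat f(0),\infty)$ if $y>0$ and in $(-\infty,\widehat f(1))$ if $y<0$. Suppose that $w_0$ is outside the interval $\left[\frac{\lambda_N(N)}{N},\frac{\lambda_1(N)}{N}+1\right]$ for all $N$ large enough. Then $$\lim_{N\to\infty}\frac{\ln S_{\lambda(N)}(e^y;N,1)}{N}=yw_0-\mathcal F(w_0)-1-\ln|e^y-1|,\qquad \mathcal F(w_0)=\int_0^1\ln\bigl|w_0-\widehat f(t)\bigr|\,dt.$$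
   Context: A signature of size $N$ is an $N$-tuple of integers $\lambda_1\ge\cdots\ge\lambda_N$. The Schur function is the symmetric Laurent polynomial $s_\lambda(u_1,\dots,u_N)=\det[u_i^{\lambda_j+N-j}]_{i,j=1}^N/\prod_{i<j}(u_i-u_j)$ and $S_\lambda(x;N,1)=s_\lambda(x,1^{N-1})/s_\lambda(1^N)$, where $1^m$ stands for $m$ arguments equal to $1$. Notation: $\widehat f(t)=f(t)+1-t$, $$R_1(\lambda(N),f)=\sum_{j=1}^N\left|\frac{\lambda_j(N)}N-f(j/N)\right|,\qquad R_\infty(\lambda(N),f)=\sup_{j=1,\dots,N}\left|\frac{\lambda_j(N)}N-f(j/N)\right|.$$ *)

(* Defs.v *)
From HB Require Import structures.
From mathcomp Require Import all_boot all_order all_algebra.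
From mathcomp Require Import all_classical all_reals all_analysis.
From mathcomp Require Import ring.

Set Implicit Arguments.
Unset Strict Implicit.
Unset Printing Implicit Defensive.

Import Order.TTheory GRing.Theory Num.Theory.
Import numFieldNormedType.Exports.

Local Open Scope classical_set_scope.
Local Open Scope ring_scope.

Definition is_signature (N : nat) (lam : N.-tuple int) : Prop :=
  sorted (fun a b : int => b <= a) lam.

Section Schur.
Context {R : realType}.

(* Laurent polynomials in [N] variables over the infinite field [R] are
   identified with the functions they induce on points with nonzero
   coordinates; values elsewhere are irrelevant. *)
Definition is_laurent (N : nat) (g : ('I_N -> R) -> R) : Prop :=
  exists s : seq (R * ('I_N -> int)), forall u, (forall i, u i != 0) ->
    g u = \sum_(m <- s) m.1 * \prod_(i < N) u i ^ m.2 i.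

(* Indices are 0-based: the exponent lambda_j + N - j (1 <= j <= N) becomes
   [tnth lam j + (N - j.+1)]. *)
Definition schur_quotient (N : nat) (lam : N.-tuple int) (u : 'I_N -> R) : R :=
  \det (\matrix_(i < N, j < N) (u i ^ (tnth lam j + (N - j.+1)%N%:Z)))
  / \prod_(i < N) \prod_(j < N | (i < j)%N) (u i - u j).

(* The quotient of determinants is meaningful only at pairwise distinct
   arguments; the Schur function is the Laurent polynomial extending it.
   Existence and uniqueness are [schurP] and [is_schur_uniq] below. *)
Definition is_schur (N : nat) (lam : N.-tuple int)
    (g : ('I_N -> R) -> R) : Prop :=
  is_laurent g /\
  forall u, (forall i, u i != 0) -> injective u -> g u = schur_quotient lam u.

Definition schur (N : nat) (lam : N.-tuple int) : ('I_N -> R) -> R :=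
  xget (fun=> 0) [set g | is_schur lam g].

(* S_lambda(x; N, 1) = s_lambda(x, 1^{N-1}) / s_lambda(1^N) *)
Definition normalized_schur (N : nat) (lam : N.-tuple int) (x : R) : R :=
  schur lam (fun i => if val i == 0%N then x else 1) / schur lam (fun=> 1).

Lemma is_laurent_ext N (g h : ('I_N -> R) -> R) :
  (forall u, (forall i, u i != 0) -> g u = h u) -> is_laurent g -> is_laurent h.
Proof. by move=> gh [s sP]; exists s => u u0; rewrite -gh// sP. Qed.

Lemma is_laurent_cst N (c : R) : is_laurent (fun _ : 'I_N -> R => c).
Proof.
exists [:: (c, fun=> 0)] => u _; rewrite big_seq1 /= big1 ?mulr1//.
Qed.

Lemma is_laurentD N (g h : ('I_N -> R) -> R) :
  is_laurent g -> is_laurent h -> is_laurent (fun u => g u + h u).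
Proof.
move=> [s sP] [t tP]; exists (s ++ t) => u u0.
by rewrite big_cat /= sP// tP.
Qed.

Lemma is_laurentM N (g h : ('I_N -> R) -> R) :
  is_laurent g -> is_laurent h -> is_laurent (fun u => g u * h u).
Proof.
move=> [s sP] [t tP].
exists [seq (a.1 * b.1, fun i => a.2 i + b.2 i) | a <- s, b <- t] => u u0.
rewrite big_allpairs_dep /= sP// tP// big_distrlr /=.
apply: eq_bigr => a _; apply: eq_bigr => b _.
rewrite mulrACA -big_split /=; congr (_ * _).
by apply: eq_bigr => i _; rewrite expfzDr.
Qed.

Lemma is_laurent_sum N (I : Type) (r : seq I) (P : pred I)
    (g : I -> ('I_N -> R) -> R) :
  (forall i, is_laurent (g i)) ->
  is_laurent (fun u => \sum_(i <- r | P i) g i u).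
Proof.
move=> gP; elim: r => [|i r IH].
  by apply: is_laurent_ext (is_laurent_cst N 0) => u _; rewrite big_nil.
case: (boolP (P i)) => Pi.
  by apply: is_laurent_ext (is_laurentD (gP i) IH) => u _; rewrite big_cons Pi.
by apply: is_laurent_ext IH => u _; rewrite big_cons (negbTE Pi).
Qed.

Lemma is_laurent_prod N (I : Type) (r : seq I) (P : pred I)
    (g : I -> ('I_N -> R) -> R) :
  (forall i, is_laurent (g i)) ->
  is_laurent (fun u => \prod_(i <- r | P i) g i u).
Proof.
move=> gP; elim: r => [|i r IH].
  by apply: is_laurent_ext (is_laurent_cst N 1) => u _; rewrite big_nil.
case: (boolP (P i)) => Pi.
  by apply: is_laurent_ext (is_laurentM (gP i) IH) => u _; rewrite big_cons Pi.
by apply: is_laurent_ext IH => u _; rewrite big_cons (negbTE Pi).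
Qed.

Lemma is_laurent_var N (i : 'I_N) (k : int) : is_laurent (fun u => u i ^ k).
Proof.
exists [:: (1, fun j => if j == i then k else 0)] => u _.
rewrite big_seq1 /= mul1r (bigD1 i)//= eqxx big1 ?mulr1//.
by move=> j /negbTE ->; rewrite expr0z.
Qed.

Lemma is_laurent_det N n (A : 'I_n -> 'I_n -> ('I_N -> R) -> R) :
  (forall i j, is_laurent (A i j)) ->
  is_laurent (fun u => \det (\matrix_(i < n, j < n) A i j u)).
Proof.
move=> AP; rewrite /determinant; apply: is_laurent_sum => s.
apply: is_laurentM; first exact: is_laurent_cst.
pose B i u := A i (perm.fun_of_perm s i) u.
apply: (@is_laurent_ext _ (fun u => \prod_i B i u)).
  by move=> u _; apply: eq_bigr => i _; rewrite mxE.
by apply: is_laurent_prod => i; exact: AP.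
Qed.

Let rootpoly N (u : 'I_N -> R) : {poly R} := \prod_(i < N) ('X - (u i)%:P).

(* remainder of 'X^a modulo [rootpoly u] *)
Fixpoint schur_rem N (a : nat) (u : 'I_N -> R) : {poly R} :=
  if a is a'.+1 then
    'X * schur_rem a' u - (schur_rem a' u)`_N.-1 *: rootpoly u
  else 1.

Lemma coef_rootpoly_laurent N k :
  is_laurent (fun u : 'I_N -> R => (rootpoly u)`_k).
Proof.
rewrite /rootpoly; elim: (index_enum _) k => [|i r IH] k.
  apply: is_laurent_ext (is_laurent_cst N (k == 0%N)%:R) => u _.
  by rewrite big_nil coef1.
have h1 : is_laurent (fun u : 'I_N -> R => - u i *
    (\prod_(i <- r) ('X - (u i)%:P))`_k).
  apply: is_laurentM (IH k).
  apply: is_laurent_ext (is_laurentM (is_laurent_cst N (-1)) (is_laurent_var i 1)).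
  by move=> u _; rewrite expr1z mulN1r.
case: k h1 => [|k] h1.
  apply: is_laurent_ext h1 => u _.
  by rewrite big_cons mulrBl coefB coefXM coefCM sub0r mulNr.
apply: is_laurent_ext (is_laurentD (IH k) h1) => u _.
by rewrite big_cons mulrBl coefB coefXM coefCM mulNr.
Qed.

Lemma coef_schur_rem_laurent N a k :
  is_laurent (fun u : 'I_N -> R => (schur_rem a u)`_k).
Proof.
elim: a k => [|a IH] k.
  by apply: is_laurent_ext (is_laurent_cst N (k == 0%N)%:R) => u _; rewrite coef1.
have h1 : is_laurent (fun u : 'I_N -> R =>
    - 1 * ((schur_rem a u)`_N.-1 * (rootpoly u)`_k)).
  apply: is_laurentM; first exact: is_laurent_cst.
  by apply: is_laurentM; [exact: IH|exact: coef_rootpoly_laurent].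
case: k h1 => [|k] h1.
  apply: is_laurent_ext h1 => u _.
  by rewrite /= coefB coefXM coefZ sub0r mulN1r.
apply: is_laurent_ext (is_laurentD (IH k) h1) => u _.
by rewrite /= coefB coefXM coefZ mulN1r.
Qed.

Lemma size_schur_rem N a (u : 'I_N -> R) :
  (0 < N)%N -> (size (schur_rem a u) <= N)%N.
Proof.
move=> N0; elim: a => [|a IH] /=; first by rewrite size_poly1.
have mP : rootpoly u \is monic by apply: monic_prod_XsubC.
have sP : size (rootpoly u) = N.+1.
  by rewrite size_prod_XsubC /index_enum -enumT size_enum_ord.
apply/leq_sizeP => k; rewrite leq_eqVlt => /predU1P[<-|Nk].
  rewrite coefB coefZ coefXM gtn_eqF//.
  have -> : (rootpoly u)`_N = 1.
    by move/monicP: mP; rewrite /lead_coef sP.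
  by rewrite mulr1 subrr.
rewrite coefB coefZ coefXM gtn_eqF ?(leq_trans _ Nk)//.
rewrite [(rootpoly u)`_k]nth_default ?sP// mulr0 subr0.
by rewrite nth_default// (leq_trans IH)// -ltnS prednK// (leq_trans _ Nk).
Qed.

Lemma horner_schur_rem N a (u : 'I_N -> R) i : (schur_rem a u).[u i] = u i ^+ a.
Proof.
elim: a => [|a IH] /=; first by rewrite hornerC.
have -> : 'X * schur_rem a u = schur_rem a u * 'X by rewrite mulrC.
rewrite hornerD hornerN hornerZ hornerMX IH.
rewrite /rootpoly horner_prod (bigD1 i)//= hornerXsubC subrr mul0r mulr0 subr0.
by rewrite exprSr.
Qed.

Lemma is_schur_ex N (lam : N.-tuple int) : exists g, is_schur lam g.
Proof.
pose K : nat := (\sum_(j < N) absz (tnth lam j))%N.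
pose e (j : 'I_N) : nat := absz (tnth lam j + (N - j.+1)%N%:Z + K%:Z).
have eE j : (e j)%:Z = tnth lam j + (N - j.+1)%N%:Z + K%:Z.
  rewrite /e gez0_abs// addrAC addr_ge0// -lerBlDl sub0r.
  rewrite (@le_trans _ _ (absz (tnth lam j))%:Z)//.
    by rewrite abszE -normrN ler_norm.
  by rewrite lez_nat /K (bigD1 j)//= leq_addr.
pose sgn : R := \prod_(i < N) \prod_(j < N | (i < j)%N) -1.
pose C (u : 'I_N -> R) := \matrix_(k < N, j < N) (schur_rem (e j) u)`_k.
exists (fun u => sgn * (\prod_i u i ^ (- K%:Z)) * \det (C u)); split.
  apply: is_laurentM; first apply: is_laurentM.
  - exact: is_laurent_cst.
  - by apply: is_laurent_prod => i; exact: is_laurent_var.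
  - by apply: is_laurent_det => i j; exact: coef_schur_rem_laurent.
move=> u u0 uI.
pose a := \row_(i < N) u i.
have V : \matrix_(i < N, j < N) (u i ^+ e j) = (Vandermonde N a)^T *m C u.
  apply/matrixP => i j; rewrite !mxE -horner_schur_rem (horner_coef_wide _ (size_schur_rem _ _ _)).
    by apply: eq_bigr => k _; rewrite !mxE mulrC.
  by case: (i) => m /=; case: (N).
rewrite /schur_quotient.
have -> : \matrix_(i < N, j < N) (u i ^ (tnth lam j + (N - j.+1)%N%:Z)) =
    diag_mx (\row_i u i ^ (- K%:Z)) *m \matrix_(i < N, j < N) (u i ^+ e j).
  apply/matrixP => i j; rewrite mul_diag_mx !mxE.
  by rewrite -[u i ^+ e j]/(u i ^ (e j)%:Z) eE -expfzDr// [- _ + _]addrC addrK.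
rewrite det_mulmx det_diag V det_mulmx det_tr det_Vandermonde.
have -> : \prod_(i < N) \prod_(j < N | (i < j)%N) (a 0 j - a 0 i) =
    sgn * \prod_(i < N) \prod_(j < N | (i < j)%N) (u i - u j).
  rewrite /sgn -big_split; apply: eq_bigr => i _ /=.
  rewrite -big_split; apply: eq_bigr => j _ /=.
  by rewrite !mxE mulN1r opprB.
have -> : \prod_i (\row_(i < N) u i ^ (- K%:Z)) 0 i = \prod_i u i ^ (- K%:Z).
  by apply: eq_bigr => i _; rewrite mxE.
have P0 : \prod_(i < N) \prod_(j < N | (i < j)%N) (u i - u j) != 0.
  apply/prodf_neq0 => i _; apply/prodf_neq0 => j ij.
  by rewrite subr_eq0; apply: contraTneq ij => /uI ->; rewrite ltnn.
move: P0; set P := \prod_i _; set d := \det _; set k := \prod_i _ => P0.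
by apply: (canRL (mulfK P0)); ring.
Qed.

Lemma schurP N (lam : N.-tuple int) : is_schur lam (schur lam).
Proof. exact: xgetPex (is_schur_ex lam). Qed.

Lemma is_schur_uniq N (lam : N.-tuple int) (g h : ('I_N -> R) -> R) :
  is_schur lam g -> is_schur lam h ->
  forall u, (forall i, u i != 0) -> g u = h u.
Proof.
move=> [[s sP] gq] [[t tP] hq] u u0.
pose v (e : R) (i : 'I_N) := u i + e * i%:R.
have vcont i : v e i @[e --> 0^'+] --> u i.
  rewrite -[X in _ --> X](_ : u i + 0 * i%:R = _); last by rewrite mul0r addr0.
  by apply: cvgD; [exact: cvg_cst|apply: cvgMl; apply: cvg_at_right_filter; exact: cvg_id].
have zcont i (k : int) : v e i ^ k @[e --> 0^'+] --> u i ^ k.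
  have ncont (n : nat) : v e i ^+ n @[e --> 0^'+] --> u i ^+ n.
    elim: n => [|n IH].
      by under eq_fun do rewrite expr0; rewrite expr0; exact: cvg_cst.
    by under eq_fun do rewrite exprS; rewrite exprS; apply: cvgM.
  case: k => n; first exact: ncont.
  by rewrite /exprz /=; apply: cvgV => //; rewrite expf_neq0.
have lcont (r : seq (R * ('I_N -> int))) :
    \sum_(m <- r) m.1 * \prod_(i < N) v e i ^ m.2 i @[e --> 0^'+] -->
    \sum_(m <- r) m.1 * \prod_(i < N) u i ^ m.2 i.
  elim: r => [|m r IH].
    by under eq_fun do rewrite big_nil; rewrite big_nil; exact: cvg_cst.
  under eq_fun do rewrite big_cons; rewrite big_cons.
  apply: cvgD => //; apply: cvgM; first exact: cvg_cst.
  elim: (index_enum _) => [|i q IHq].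
    by under eq_fun do rewrite big_nil; rewrite big_nil; exact: cvg_cst.
  by under eq_fun do rewrite big_cons; rewrite big_cons; apply: cvgM.
have v0 : \forall e \near 0^'+, forall i, v e i != 0.
  apply: filter_forall => i.
  have /cvgr_neq0 := vcont i; exact.
have vI : \forall e \near 0^'+, forall i j : 'I_N, i != j -> v e i != v e j.
  apply: filter_forall => i; apply: filter_forall => j.
  have [->|ij] := eqVneq i j; first exact: nearW.
  have [uij|uij] := eqVneq (u i) (u j).
    near=> e => _; rewrite /v uij (inj_eq (addrI _)).
    have e0 : e != 0 by rewrite gt_eqF//; near: e; exact: nbhs_right_gt.
    by rewrite (inj_eq (mulfI e0)) eqr_nat.
  have /cvgr_neq0 : v e i - v e j @[e --> 0^'+] --> u i - u j by apply: cvgB.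
  rewrite subr_eq0 => /(_ uij); apply: filterS => e.
  by rewrite subr_eq0.
have gv : g (v e) @[e --> 0^'+] --> g u.
  rewrite sP//; apply: cvg_trans (lcont s); apply: near_eq_cvg.
  by near=> e; rewrite sP//; near: e.
have hv : g (v e) @[e --> 0^'+] --> h u.
  rewrite tP//; apply: cvg_trans (lcont t); apply: near_eq_cvg.
  near=> e.
  have vi0 i : v e i != 0 by move: i; near: e.
  rewrite gq//; first by rewrite -tP// hq//; move=> i j vij;
    apply/eqP; apply: contra_eqT vij; move: i j; near: e.
  by move=> i j vij; apply/eqP; apply: contra_eqT vij; move: i j; near: e.
exact: (cvg_unique _ gv hv).
Unshelve. all: by end_near. Qed.

End Schur.

Section Profile.
Context {R : realType}.

(* Functions on [0, 1] are represented by total functions whose values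
   outside [0, 1] are never used. *)
Definition piecewise_continuous (a b : R) (f : R -> R) : Prop :=
  exists s : seq R, itv_partition a b s /\
  forall i, (i < size s)%N ->
    let p := nth b (a :: s) i in
    let q := nth b (a :: s) i.+1 in
    [/\ {in `]p, q[, continuous f},
        cvg (f x @[x --> p^'+]) &
        cvg (f x @[x --> q^'-])].

Definition fhat (f : R -> R) (t : R) : R := f t + 1 - t.

Definition profile_dev (N : nat) (lam : N.-tuple int) (f : R -> R)
    (j : 'I_N) : R :=
  `|(tnth lam j)%:~R / N%:R - f (j.+1%:R / N%:R)|.

Definition R1 (N : nat) (lam : N.-tuple int) (f : R -> R) : R :=
  \sum_(j < N) profile_dev lam f j.

(* A maximum over finitely many nonnegative values, with 0 when N = 0. *)
Definition Rinfty (N : nat) (lam : N.-tuple int) (f : R -> R) : R :=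
  \big[Order.max/0]_(j < N) profile_dev lam f j.

Definition logpot (f : R -> R) (w : R) : R :=
  \int[lebesgue_measure]_(t in `[0, 1]) ln `|w - fhat f t|.

End Profile.

(* Main.v *)
Require Import Defs.
From HB Require Import structures.
From mathcomp Require Import all_boot all_order all_algebra.
From mathcomp Require Import all_classical all_reals all_analysis.
From mathcomp Require Import measurable_realfun.
From mathcomp Require Import ring lra.
Import Order.TTheory GRing.Theory Num.Theory.
Import numFieldNormedType.Exports.
Local Open Scope classical_set_scope.
Local Open Scope ring_scope.

(** Write [l_i = lambda_i + N - i] and [x_i = l_i / N].  Letting all but one
    variable of the Schur function tend to 1 along a geometric progression turns
    both determinants into Vandermonde determinants and gives
    [S_lambda(x; N, 1) = (N-1)! / (x-1)^(N-1) * sum_k x^(l_k) / prod_(j <> k) (l_k - l_j)].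
    For [x = e^y] the sum is a divided difference of [z |-> e^(y z)], i.e. the
    density at [y] of a sum of independent exponential variables of rates [w - l_i],
    up to the factor [e^(y w) / prod_i (w - l_i)], for any [w] above all the [l_i].
    In this probabilistic form the saddle point is replaced by an exponential
    change of measure: the density is at most one of the rates, and, when [w] is
    scaled slightly above [N w_0], so that the mean of the sum is slightly less
    than [y], Chernoff bounds show that it is at least [e^(-o(N))].  Working at
    [w > w_0] keeps the rates of order [N] even though the [x_i] may approach
    [w_0]; the theorem follows by letting [w] decrease to [w_0].  The logarithm of
    the product and the mean are Riemann sums of monotone functions, and Stirling's
    estimate for [(N-1)!] gives the term [-1].  The case [y < 0] reduces to [y > 0]
    by changing the signs of [y], [w_0] and all the [x_i]. *)

(** * Schur functions at (x, 1, ..., 1) *)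

Section SchurSpecialization.
Context {R : realType}.

Lemma cvg_exprz T (F : set_system T) {FF : Filter F} (f : T -> R) (a : R) (m : int) :
  a != 0 -> f x @[x --> F] --> a -> f x ^ m @[x --> F] --> a ^ m.
Proof.
move=> a0 fa.
have fX n : f x ^+ n @[x --> F] --> a ^+ n.
  elim: n => [|n IH].
    by under eq_fun do rewrite expr0; rewrite expr0; exact: cvg_cst.
  by under eq_fun do rewrite exprS; rewrite exprS; apply: cvgM.
case: m => n; first exact: fX.
by rewrite /exprz; apply: cvgV; rewrite ?expf_neq0.
Qed.

Lemma cvg_prodr T (F : set_system T) {FF : Filter F} (I : Type) (r : seq I)
    (P : pred I) (f : I -> T -> R) (a : I -> R) :
  (forall i, P i -> f i x @[x --> F] --> a i) ->
  \prod_(i <- r | P i) f i x @[x --> F] --> \prod_(i <- r | P i) a i.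
Proof. by move=> fa; apply: cvg_big => //; exact: mul_continuous. Qed.

Lemma cvg_sumr T (F : set_system T) {FF : Filter F} (I : Type) (r : seq I)
    (P : pred I) (f : I -> T -> R) (a : I -> R) :
  (forall i, P i -> f i x @[x --> F] --> a i) ->
  \sum_(i <- r | P i) f i x @[x --> F] --> \sum_(i <- r | P i) a i.
Proof. by move=> fa; apply: cvg_big => //; exact: add_continuous. Qed.

(** The determinant formula holds only at distinct arguments; values at repeated arguments are
    reached as limits through this continuity. *)
Lemma cvg_laurent T (F : set_system T) {FF : Filter F} N (g : ('I_N -> R) -> R)
    (u : 'I_N -> R) (v : T -> 'I_N -> R) :
  is_laurent g -> (forall i, u i != 0) -> (forall x i, v x i != 0) ->
  (forall i, v x i @[x --> F] --> u i) -> g (v x) @[x --> F] --> g u.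
Proof.
move=> [s gs] u0 v0 vu; rewrite gs//.
under eq_fun do rewrite gs//.
apply: cvg_sumr => m _; apply: cvgM; first exact: cvg_cst.
by apply: cvg_prodr => i _; exact: cvg_exprz.
Qed.

Lemma cvg_expRM_at0 (a : R) : expR (e * a) @[e --> 0^'+] --> (1 : R).
Proof.
rewrite -(expR0 R) -[X in expR X](mul0r a).
apply: continuous_cvg; first exact: continuous_expR.
by apply: cvgM; [apply: cvg_at_right_filter; exact: cvg_id|exact: cvg_cst].
Qed.

Lemma cvg_expRM_slope (a : R) : (expR (e * a) - 1) / e @[e --> 0^'+] --> a.
Proof.
apply: cvg_dnbhs_at_right.
have d : is_derive (0 : R) (1 : R) (fun u : R => expR (u * a)) a.
  rewrite (_ : (fun u => _) = expR \o (a *: id)); last first.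
    by apply/funext => u /=; rewrite /GRing.scale /= mulrC.
  by apply: is_derive_eq; rewrite /GRing.scale /= scaler0 expR0 mul1r mulr1.
case: d => /cvg_ex [l dl] dv.
have la : l = a by rewrite -dv; apply/esym; exact: (cvg_lim (@Rhausdorff R) dl).
move: dl; rewrite la; apply: cvg_trans; apply: near_eq_cvg; near=> e.
by rewrite /= mul0r expR0 addr0 /GRing.scale /= mulr1 mulrC.
Unshelve. all: by end_near. Qed.

(** Factors of this form make up a quotient of two Vandermonde products in powers of [expR e].
    Dividing both differences by [e] turns them into slopes at 0. *)
Lemma cvg_expRM_ratio (a b c d : R) : c != d ->
  (expR (e * a) - expR (e * b)) / (expR (e * c) - expR (e * d)) @[e --> 0^'+] -->
  (a - b) / (c - d).
Proof.
move=> cd.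
have sl (p q : R) : (expR (e * p) - expR (e * q)) / e @[e --> 0^'+] --> p - q.
  have : (expR (e * p) - 1) / e - (expR (e * q) - 1) / e @[e --> 0^'+] --> p - q.
    by apply: cvgB; exact: cvg_expRM_slope.
  apply: cvg_trans; apply: near_eq_cvg; near=> e.
  by rewrite -mulrBl; congr (_ / _); ring.
have : ((expR (e * a) - expR (e * b)) / e) / ((expR (e * c) - expR (e * d)) / e)
    @[e --> 0^'+] --> (a - b) / (c - d).
  by apply: cvgM => //; apply: cvgV => //; rewrite subr_eq0.
apply: cvg_trans; apply: near_eq_cvg; near=> e.
have e0 : e != 0 by rewrite gt_eqF//; near: e; exact: nbhs_right_gt.
by rewrite invfM invrK mulrACA mulVf ?mulr1.
Unshelve. all: by end_near. Qed.

(** A pair [i < j] either avoids [k], and is then enumerated through [lift k], or contains it.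
    Splitting off one index matches a full product over pairs with that of a minor. *)
Lemma prod_pairs_lift n (k : 'I_n.+1) (G : 'I_n.+1 -> 'I_n.+1 -> R) :
  \prod_(i < n.+1) \prod_(j < n.+1 | (i < j)%N) G i j =
  (\prod_(i < n) \prod_(j < n | (i < j)%N) G (lift k i) (lift k j)) *
  \prod_(j < n) (if (lift k j < k)%N then G (lift k j) k else G k (lift k j)).
Proof.
rewrite (bigD1_ord k)//= mulrC.
have E i : \prod_(j < n.+1 | (lift k i < j)%N) G (lift k i) j =
   (\prod_(j < n | (i < j)%N) G (lift k i) (lift k j)) *
   (if (lift k i < k)%N then G (lift k i) k else 1).
  rewrite big_mkcond (bigD1_ord k)//= mulrC; congr (_ * _).
  rewrite -big_mkcond; apply: eq_bigl => j.
  by rewrite !ltnNge; congr (~~ _); rewrite /= leq_bump2.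
rewrite (eq_bigr _ (fun i _ => E i)) big_split -mulrA; congr (_ * _).
rewrite [X in _ * X]big_mkcond [X in _ * X](bigD1_ord k)//= ltnn mul1r.
rewrite -big_split /=.
apply: eq_bigr => j _.
have := neq_lift k j; rewrite -val_eqE /= neq_ltn => /orP[] h.
  by rewrite h ltnNge ltnW// mul1r.
by rewrite h ltnNge ltnW// mulr1.
Qed.

(** Among the indices other than [k], exactly [n - k] exceed it. *)
Lemma prod_sign n (k : 'I_n.+1) :
  \prod_(j < n) (if (lift k j < k)%N then 1 else -1) = (-1) ^+ (n + k) :> R.
Proof.
have -> : \prod_(j < n) (if (lift k j < k)%N then 1 else -1 : R) =
    \prod_(j < n) (-1 * (if (j < k)%N then -1 else 1)).
  apply: eq_bigr => j _; rewrite /= /bump.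
  by case: (leqP k j) => kj; rewrite ?add1n ?add0n ?kj ?mulrNN ?mulr1// ltnNge ltnW.
rewrite big_split /= prodr_const card_ord exprD -big_mkcond /=; congr (_ * _).
rewrite -(big_ord_widen n (fun=> -1 : R)) ?prodr_const ?card_ord//.
by rewrite -ltnS.
Qed.

Lemma expR_exprz (t : R) (m : int) : expR t ^ m = expR (t * m%:~R).
Proof.
case: m => n; first by rewrite -exprnP -pmulrn expRM_natr.
by rewrite /exprz NegzE mulrNz mulrN expRN -pmulrn expRM_natr.
Qed.

Lemma det_geometric n (b : 'I_n -> R) :
  \det (\matrix_(i < n, j < n) b j ^+ i) =
  \prod_(i < n) \prod_(j < n | (i < j)%N) (b j - b i).
Proof.
have -> : \matrix_(i < n, j < n) b j ^+ i = Vandermonde n (\row_j b j).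
  by apply/matrixP => i j; rewrite !mxE.
rewrite det_Vandermonde; apply: eq_bigr => i _; apply: eq_bigr => j _.
by rewrite !mxE.
Qed.

Definition shifted_part {N} (lam : N.-tuple int) (i : 'I_N) : int :=
  tnth lam i + (N - i.+1)%N%:Z.

(** This is Weyl's dimension formula. At the arguments [expR (e * i)] the entry in row [i] and
    column [j] is the [i]-th power of [expR (e * L j)], so the numerator is a Vandermonde
    determinant too; then [e] tends to 0. *)
Lemma schur_ones N (lam : N.-tuple int) (L := shifted_part lam) :
  schur lam (fun=> 1) = \prod_(i < N) \prod_(j < N | (i < j)%N)
    (((L j)%:~R - (L i)%:~R) / (i%:R - j%:R)) :> R.
Proof.
have [slau squo] := @schurP R N lam.
pose v (e : R) (i : 'I_N) := expR (e * i%:R).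
have v0 e i : v e i != 0 by rewrite gt_eqF ?expR_gt0.
have c1 : schur lam (v e) @[e --> 0^'+] --> (schur lam (fun=> 1) : R).
  by apply: cvg_laurent => // i; rewrite ?oner_eq0//; exact: cvg_expRM_at0.
apply: (cvg_unique (@Rhausdorff R) c1).
have : \prod_(i < N) \prod_(j < N | (i < j)%N)
    ((expR (e * (L j)%:~R) - expR (e * (L i)%:~R)) /
     (expR (e * i%:R) - expR (e * j%:R))) @[e --> 0^'+] -->
    \prod_(i < N) \prod_(j < N | (i < j)%N)
    (((L j)%:~R - (L i)%:~R) / (i%:R - j%:R) : R).
  apply: cvg_prodr => i _; apply: cvg_prodr => j ij.
  by apply: cvg_expRM_ratio; rewrite eqr_nat ltn_eqF.
apply: cvg_trans; apply: near_eq_cvg; near=> e.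
have e0 : e != 0 by rewrite gt_eqF//; near: e; exact: nbhs_right_gt.
rewrite squo//; last first.
  move=> i j /expR_inj /(mulfI e0) /eqP; rewrite eqr_nat => /eqP.
  exact: val_inj.
rewrite /schur_quotient.
have -> : \matrix_(i < N, j < N) (v e i ^ (tnth lam j + (N - j.+1)%N%:Z)) =
    \matrix_(i < N, j < N) (expR (e * (L j)%:~R)) ^+ i.
  apply/matrixP => i j; rewrite !mxE expR_exprz -expRM_natr.
  by congr expR; rewrite mulrAC.
rewrite det_geometric -prodf_div; apply: eq_bigr => i _.
by rewrite -prodf_div.
Unshelve. all: by end_near. Qed.

(** Expansion along the row of [x] leaves minors to which the same geometric progression applies. *)
Lemma schur_one_variable n (lam : n.+1.-tuple int) (x : R)
    (L := shifted_part lam) : x != 0 -> x != 1 ->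
  schur lam (fun i => if val i == 0%N then x else 1) =
  \sum_(k < n.+1) x ^ L k * ((-1) ^+ k *
    \prod_(i < n) \prod_(j < n | (i < j)%N)
      (((L (lift k j))%:~R - (L (lift k i))%:~R) / (i%:R - j%:R))) / (x - 1) ^+ n.
Proof.
move=> x0 x1.
have [slau squo] := @schurP R n.+1 lam.
(* The variables after the first form a progression starting at 1, hence the predecessor of [i] in
   the exponent. *)
pose v (e : R) (i : 'I_n.+1) := if val i == 0%N then x else expR (e * i.-1%:R).
have v0 e i : v e i != 0.
  by rewrite /v; case: ifP => // _; rewrite gt_eqF ?expR_gt0.
set u := (fun i : 'I_n.+1 => _).
have c1 : schur lam (v e) @[e --> 0^'+] --> schur lam u.
  apply: cvg_laurent => // i; rewrite /u /v.
    by case: ifP => // _; rewrite oner_eq0.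
  by case: ifP => // _; [exact: cvg_cst|exact: cvg_expRM_at0].
apply: (cvg_unique (@Rhausdorff R) c1).
have : \sum_(k < n.+1) x ^ L k * ((-1) ^+ k *
    \prod_(i < n) \prod_(j < n | (i < j)%N)
    ((expR (e * (L (lift k j))%:~R) - expR (e * (L (lift k i))%:~R)) /
     (expR (e * i%:R) - expR (e * j%:R)))) /
    \prod_(j < n) (x - expR (e * j%:R))
     @[e --> 0^'+] -->
  \sum_(k < n.+1) x ^ L k * ((-1) ^+ k *
    \prod_(i < n) \prod_(j < n | (i < j)%N)
      (((L (lift k j))%:~R - (L (lift k i))%:~R) / (i%:R - j%:R))) / (x - 1) ^+ n.
  apply: cvg_sumr => k _; apply: cvgM.
    apply: cvgM; first exact: cvg_cst.
    apply: cvgM; first exact: cvg_cst.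
    apply: cvg_prodr => i _; apply: cvg_prodr => j ij.
    by apply: cvg_expRM_ratio; rewrite eqr_nat ltn_eqF.
  apply: cvgV; first by rewrite expf_neq0// subr_eq0.
  rewrite -[X in (x - 1) ^+ X](card_ord n) -prodr_const.
  apply: cvg_prodr => j _; apply: cvgB; first exact: cvg_cst.
  exact: cvg_expRM_at0.
apply: cvg_trans; apply: near_eq_cvg; near=> e.
have e0 : e != 0 by rewrite gt_eqF//; near: e; exact: nbhs_right_gt.
(* Since [x] is not 1, it eventually avoids the whole progression, so the arguments are pairwise
   distinct. *)
have xe : forall j : 'I_n, x - expR (e * j%:R) != 0.
  near: e; apply: filter_forall => j.
  have : x - expR (e * j%:R) @[e --> 0^'+] --> x - 1.
    by apply: cvgB; [exact: cvg_cst|exact: cvg_expRM_at0].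
  by move/cvgr_neq0; apply; rewrite subr_eq0.
rewrite squo//; last first.
  move=> i j; rewrite /v.
  have [i'|->] := unliftP ord0 i; have [j'|->] := unliftP ord0 j => //=.
  - move=> -> -> /= /expR_inj /(mulfI e0) /eqP; rewrite eqr_nat => /eqP ij.
    by congr lift; exact: val_inj.
  - by move=> -> /= /eqP; rewrite eq_sym -subr_eq0 (negbTE (xe _)).
  - by move=> -> /= /eqP; rewrite -subr_eq0 (negbTE (xe _)).
rewrite /schur_quotient (expand_det_row _ ord0) (prod_pairs_lift n ord0) /=.
rewrite -mulr_suml invfM mulrA; congr (_ * _).
rewrite mulr_suml; apply: eq_bigr => k _; apply/esym.
rewrite mxE -mulrA; congr (_ * _).
rewrite /cofactor add0n -mulrA; congr (_ * _).
have -> : row' ord0 (col' k (\matrix_(i < n.+1, j < n.+1)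
    (v e i ^ (tnth lam j + (n.+1 - j.+1)%N%:Z)))) =
    \matrix_(i < n, j < n) (expR (e * (L (lift k j))%:~R)) ^+ i.
  apply/matrixP => i j; rewrite !mxE /v /= expR_exprz -expRM_natr.
  by congr expR; rewrite mulrAC.
rewrite det_geometric -prodf_div; apply: eq_bigr => i _.
by rewrite -prodf_div.
Unshelve. all: by end_near. Qed.

Lemma normalized_schurE n (lam : n.+1.-tuple int) (x : R)
    (L := fun k => (shifted_part lam k)%:~R : R) : injective L ->
  x != 0 -> x != 1 ->
  normalized_schur lam x = n`!%:R / (x - 1) ^+ n *
    \sum_(k < n.+1) x ^ shifted_part lam k / \prod_(j < n.+1 | j != k) (L k - L j).
Proof.
move=> LI x0 x1; rewrite /normalized_schur schur_one_variable// schur_ones.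
rewrite mulr_suml mulr_sumr; apply: eq_bigr => k _.
set A := (X in (-1) ^+ k * X); set P := \prod_(j < n.+1 | j != k) _.
have n0 : n`!%:R != 0 :> R by rewrite pnatr_eq0 -lt0n fact_gt0.
have P0 : P != 0.
  apply/prodf_neq0 => j jk. by rewrite subr_eq0 (inj_eq LI) eq_sym.
have A0 : A != 0.
  apply/prodf_neq0 => i _; apply/prodf_neq0 => j ij.
  rewrite mulf_neq0 ?invr_eq0 ?subr_eq0 ?eqr_nat ?(ltn_eqF ij)//.
  by rewrite (inj_eq LI) (inj_eq lift_inj) -val_eqE /= gtn_eqF.
(* The numerator is split at [k]: the pairs containing [k] give [P] up to sign. The denominator is
   split at index 0, where the factors [0 - (j + 1)] multiply to (-1)^n n!. The remaining pairs form
   [A]. *)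
have -> : \prod_(i < n.+1) \prod_(j < n.+1 | (i < j)%N)
      (((shifted_part lam j)%:~R - (shifted_part lam i)%:~R) / (i%:R - j%:R)) =
    A * (P * (-1) ^+ (n + k)) / ((-1) ^+ n * n`!%:R).
  under eq_bigr do rewrite prodf_div.
  rewrite prodf_div (prod_pairs_lift n k) (prod_pairs_lift n ord0) /=.
  rewrite [in LHS]invfM mulrACA -[RHS]mulrA; congr (_ * (_ / _)).
  - rewrite /A; under [RHS]eq_bigr do rewrite prodf_div.
    rewrite prodf_div; congr (_ / _).
    apply: eq_bigr => i _; apply: eq_bigr => j _.
    by rewrite /bump !add1n -!natr1 opprD addrACA subrr addr0.
  - rewrite -prod_sign /P [in RHS]big_mkcond [in RHS](bigD1_ord k)//= eqxx mul1r.
    rewrite -big_split /=.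
    apply: eq_bigr => j _; rewrite eq_sym neq_lift.
    case: ifP => _; rewrite ?mulr1 ?mulrN1 ?opprB//.
  - rewrite -[in RHS](card_ord n) -prodr_const card_ord fact_prod.
    rewrite big_add1 big_mkord natr_prod -big_split /=.
    by apply: eq_bigr => j _; rewrite /bump add1n sub0r mulN1r.
have x10 : x - 1 != 0 by rewrite subr_eq0.
have s0 m : (-1) ^+ m != 0 :> R by rewrite expf_neq0// oppr_eq0 oner_eq0.
rewrite exprD; have := s0 n; have := s0 k; have : (-1) ^+ k * (-1) ^+ k = 1 :> R.
  by rewrite -exprMn mulrNN mulr1 expr1n.
set a := (-1) ^+ k; set b := (-1) ^+ n => aa a0 b0.
field; rewrite ?P0 ?n0 ?A0 ?a0 ?b0 ?expf_neq0//.
Qed.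

End SchurSpecialization.

(** * Sums of exponential variables *)

Lemma ger0_is_derive_le (R : realType) (F F' : R -> R) (a b : R) :
  (forall x : R, is_derive x 1 F (F' x)) -> (forall x, a <= x -> 0 <= F' x) ->
  a <= b -> F a <= F b.
Proof.
move=> dF F'0 ab.
have cF : {within `[a, b], continuous F}.
  by apply: derivable_within_continuous => x _; case: (dF x).
have [x xab E] := MVT_segment ab (fun x _ => dF x) cF.
rewrite -subr_ge0 E mulr_ge0 ?subr_ge0// F'0//.
by move: xab; rewrite in_itv /= => /andP[].
Qed.

Section Hypoexponential.
Context {R : realType}.
Implicit Types (s : seq R) (w x a t : R).

(* The divided difference of [z |-> e^(t z)] at the pairwise distinct nodes [s]. *)
Definition hypo s t : R :=
  \sum_(x <- s) expR (t * x) / \prod_(z <- s | z != x) (x - z).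

Lemma hypo_cons a s t : a \notin s -> hypo (a :: s) t =
  expR (t * a) / \prod_(z <- s) (a - z) +
  \sum_(x <- s) expR (t * x) / ((x - a) * \prod_(z <- s | z != x) (x - z)).
Proof.
move=> as_; rewrite /hypo big_cons big_cons eqxx /=; congr (_ / _ + _).
  rewrite big_seq_cond [RHS]big_seq; apply: eq_bigl => z.
  by case: eqVneq => [->|]; rewrite ?andbT// (negbTE as_).
apply: eq_big_seq => x xs; rewrite big_cons.
by case: eqVneq as_ => [->|//]; rewrite xs.
Qed.

#[local] Instance is_derive_expRM x t :
  is_derive t (1 : R) (fun u : R => expR (u * x)) (x * expR (t * x)).
Proof.
rewrite (_ : (fun u => _) = expR \o (x *: id)); last first.
  by apply/funext => u /=; rewrite /GRing.scale /= mulrC.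
apply: is_derive_eq; rewrite /GRing.scale /=. by rewrite mulr1 mulrC [x *: t]mulrC.
Qed.

(** Applying d/dt - a multiplies the term of node [x] by [x - a], which cancels one factor of its
    denominator and kills the term of [a]. *)
Lemma is_derive_hypo_cons a s t : uniq (a :: s) ->
  is_derive t (1 : R) (hypo (a :: s)) (a * hypo (a :: s) t + hypo s t).
Proof.
move=> /= /andP[as_ us].
have dterm x (c : R) : is_derive t (1 : R) (fun t : R => expR (t * x) / c)
    (x * (expR (t * x) / c)).
  apply: is_derive_eq; rewrite /GRing.scale /=. by ring.
have dsum r (c : R -> R) : is_derive t 1
    (fun t : R => \sum_(x <- r) expR (t * x) / c x)
    (\sum_(x <- r) x * (expR (t * x) / c x)).
  elim: r => [|x r IH].
    rewrite (_ : (fun _ => _) = cst 0) ?big_nil; first exact: is_derive_cst.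
    by apply/funext => u; rewrite big_nil.
  rewrite (_ : (fun _ => _) = (fun u : R => expR (u * x) / c x) +
    (fun u => \sum_(x <- r) expR (u * x) / c x)).
    by rewrite big_cons; exact: is_deriveD.
  by apply/funext => u; rewrite big_cons.
apply: (is_derive_eq (dsum (a :: s) (fun x => \prod_(z <- a :: s | z != x) (x - z)))).
rewrite /hypo mulr_sumr !big_cons -addrA.
congr (_ + _); rewrite /hypo -big_split /=; apply: eq_big_seq => x xs.
have ax : a != x by apply: contraNneq as_ => ->.
rewrite big_cons ax invfM [X in _ = _ + X](_ : _ =
  (x - a) * (expR (t * x) / (x - a) / \prod_(z <- s | z != x) (x - z))).
  by ring.
by rewrite -mulrA mulrCA [_ * (_^-1 * _)]mulrA divff ?mul1r ?subr_eq0 1?eq_sym.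
Qed.

(** The recursion of divided differences, term by term from (a - b)/((x - a)(x - b)) = 1/(x - a) -
    1/(x - b). *)
Lemma hypo_exchange a b s t : uniq [:: a, b & s] ->
  (a - b) * hypo [:: a, b & s] t = hypo (a :: s) t - hypo (b :: s) t.
Proof.
move=> /= /and3P[]; rewrite inE negb_or => /andP[ab as_] bs us.
have abn : a - b != 0 by rewrite subr_eq0.
have ba : b - a != 0 by rewrite subr_eq0 eq_sym.
rewrite hypo_cons ?inE ?negb_or ?ab// !big_cons eqxx /=.
rewrite (hypo_cons _ _ _ as_) (hypo_cons _ _ _ bs).
have bP : \prod_(z <- s | z != b) (b - z) = \prod_(z <- s) (b - z).
  rewrite big_seq_cond [RHS]big_seq; apply: eq_bigl => z.
  by case: eqVneq => [->|]; rewrite ?andbT// (negbTE bs).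
rewrite bP; set P := \prod_(z <- s) (a - z); set Q := \prod_(z <- s) (b - z).
rewrite opprD addrACA -addrA !mulrDr; congr (_ + _).
  by rewrite invfM; move: P^-1 => p; field.
rewrite invfM; move: Q^-1 => q; congr (_ + _).
  by field.
rewrite mulr_sumr -sumrN -big_split /=; apply: eq_big_seq => x xs.
have xa : x - a != 0 by rewrite subr_eq0; apply: contraNneq as_ => <-.
have xb : x - b != 0 by rewrite subr_eq0; apply: contraNneq bs => <-.
rewrite big_cons eq_sym -subr_eq0 xb !invfM.
set p := (\prod_(_ <- _ | _) _)^-1; field.
by rewrite xa xb.
Qed.


(** At time 0 this is a divided difference of the constant 1, which vanishes as soon as there are
    two nodes. The induction is on the size because [hypo_exchange] produces [a :: s], which is not
    a tail of the list. *)
Lemma hypo_at0 s : uniq s -> hypo s 0 = (size s == 1%N)%:R.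
Proof.
have [n] := ubnP (size s); elim: n s => // n IH [|a [|b s]] /= sn us.
- by rewrite /hypo big_nil.
- by rewrite /hypo !big_cons !big_nil eqxx /= mul0r expR0 addr0 invr1 mulr1.
have [/andP[_ ubs] uas] : uniq [:: b & s] /\ uniq [:: a & s].
  by move: us; rewrite /= inE negb_or => /and3P[/andP[_ ->] -> ->].
have ab : a - b != 0.
  by move: us; rewrite /= inE negb_or subr_eq0 => /andP[/andP[]].
apply: (mulfI ab); rewrite hypo_exchange// mulr0 !IH ?subrr//.
by move: us => /andP[].
Qed.

(** The function e^(-a t) [hypo (a :: s) t] is nonnegative at 0 and has derivative e^(-a t)
    [hypo s t], which is nonnegative by induction. *)
Lemma hypo_ge0 s t : uniq s -> 0 <= t -> 0 <= hypo s t.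
Proof.
elim: s t => [|a s IH] t us t0; first by rewrite /hypo big_nil.
have h : (size s == 0%N)%:R <= expR (t * - a) * hypo (a :: s) t.
  rewrite -[leLHS]mul1r -[X in X * _](expR0 R) -[X in expR X](mul0r (- a)).
  rewrite -(hypo_at0 (a :: s))//.
  pose F u := expR (u * - a) * hypo (a :: s) u.
  have dF (u : R) : is_derive u (1 : R) F (expR (u * - a) * hypo s u).
    have := is_derive_hypo_cons a s u us => ?.
    by apply: is_derive_eq; rewrite /GRing.scale /=; ring.
  have dF0 u : 0 <= u -> 0 <= expR (u * - a) * hypo s u.
    by move=> u0; rewrite mulr_ge0 ?expR_ge0// IH//; move: us => /andP[].
  exact: (ger0_is_derive_le _ F _ 0 t dF dF0 t0).
rewrite -(pmulr_rge0 (hypo (a :: s) t) (expR_gt0 (t * - a))).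
by apply: le_trans h; rewrite ler0n.
Qed.

(** Same integrating factor as for [hypo_ge0]; the mean value theorem keeps the inequality strict,
    which is what logarithms require. *)
Lemma hypo_gt0 s t : uniq s -> s != [::] -> 0 < t -> 0 < hypo s t.
Proof.
elim: s t => [//|a [|b s] IH] t us _ t0.
  by rewrite /hypo !big_cons !big_nil eqxx /= addr0 invr1 mulr1 expR_gt0.
pose r := b :: s; pose F u := expR (u * - a) * hypo (a :: r) u.
have dF (u : R) : is_derive u (1 : R) F (expR (u * - a) * hypo r u).
  have := is_derive_hypo_cons a r u us => ?.
  by apply: is_derive_eq; rewrite /GRing.scale /=; ring.
have cF : {within `[0, t], continuous F}.
  by apply: derivable_within_continuous => u _; case: (dF u).
have [c] := MVT t0 (fun u _ => dF u) cF.
rewrite in_itv /= => /andP[c0 _]; rewrite {2}/F hypo_at0// mulr0 !subr0 => E.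
rewrite -(pmulr_rgt0 _ (expR_gt0 (t * - a))) -/(F t) E.
by rewrite !mulr_gt0 ?expR_gt0// IH//; move: us => /andP[].
Qed.

(* For [w] above all the nodes, the density at [t] and the tail probability
   [P(S > t)] of the sum [S] of independent exponential variables with rates
   [w - x], for [x] in [s]. *)
Definition hypo_density w s t := \prod_(x <- s) (w - x) * expR (t * - w) * hypo s t.

Fixpoint hypo_tail w s t : R :=
  if s is a :: s' then
    hypo_tail w s' t + \prod_(x <- s') (w - x) * expR (t * - w) * hypo s t
  else 0.

(** The sum over [a :: s] ends at [t] at rate [w - a], provided that [t] falls between the partial
    sum over [s] and the full sum; the difference of tails is the probability of that event. *)
Lemma hypo_densityE w a s t : hypo_density w (a :: s) t =
  (w - a) * (hypo_tail w (a :: s) t - hypo_tail w s t).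
Proof. by rewrite /= [X in _ * X]addrAC subrr add0r /hypo_density big_cons; ring. Qed.

Lemma is_derive_hypo_tail w s t : uniq s ->
  is_derive t (1 : R) (hypo_tail w s) (- hypo_density w s t).
Proof.
elim: s => [|a s IH] us.
  by rewrite /hypo_density /hypo !big_nil mulr0 oppr0; exact: is_derive_cst.
have /IH ? : uniq s by move: us => /andP[].
have := is_derive_hypo_cons a s t us => ?.
by apply: is_derive_eq; rewrite /hypo_density big_cons /GRing.scale /=; ring.
Qed.

Lemma hypo_tail_ge0 w s t : uniq s -> (forall x, x \in s -> x < w) ->
  0 <= t -> 0 <= hypo_tail w s t.
Proof.
elim: s => [//|a s IH] us sw t0 /=.
have sw' x : x \in s -> x < w by move=> xs; rewrite sw// inE xs orbT.
rewrite addr_ge0 ?IH//; first by move: us => /andP[].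
rewrite !mulr_ge0 ?expR_ge0 ?hypo_ge0// big_seq prodr_ge0// => x /sw'.
by rewrite subr_ge0; exact: ltW.
Qed.

Lemma hypo_tail_at0 w s : uniq s -> hypo_tail w s 0 = (s != [::])%:R.
Proof.
elim: s => [//|a s IH] us /=; rewrite hypo_at0// IH; last by move: us => /andP[].
rewrite mul0r expR0 mulr1 /=; case: s {IH us} => [|b s] /=.
  by rewrite big_nil mulr1 add0r.
by rewrite mulr0 addr0.
Qed.

Lemma hypo_density_ge0 w s t : uniq s -> (forall x, x \in s -> x < w) ->
  0 <= t -> 0 <= hypo_density w s t.
Proof.
move=> us sw t0; rewrite !mulr_ge0 ?expR_ge0 ?hypo_ge0//.
by rewrite big_seq prodr_ge0// => x /sw; rewrite subr_ge0; exact: ltW.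
Qed.

Lemma hypo_tail_le1 w s t : uniq s -> (forall x, x \in s -> x < w) ->
  0 <= t -> hypo_tail w s t <= 1.
Proof.
move=> us sw t0.
have dF (u : R) : is_derive u (1 : R) (fun u => - hypo_tail w s u) (hypo_density w s u).
  have := is_derive_hypo_tail w s u us => ?.
  by apply: is_derive_eq; rewrite opprK.
have dF0 u : 0 <= u -> 0 <= hypo_density w s u by exact: hypo_density_ge0.
have := ger0_is_derive_le _ _ _ 0 t dF dF0 t0; rewrite lerN2.
by move/le_trans; apply; rewrite hypo_tail_at0// lern1 leq_b1.
Qed.

(** By [hypo_densityE] the density is at most the rate [w - a]; dividing by this rate leaves the
    product over [s] alone. *)
Lemma hypo_ub w a s t : uniq (a :: s) -> (forall x, x \in a :: s -> x < w) ->
  0 <= t -> hypo (a :: s) t * \prod_(x <- s) (w - x) <= expR (t * w).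
Proof.
move=> us sw t0; have /= := hypo_tail_le1 w (a :: s) t us sw t0.
have : 0 <= hypo_tail w s t.
  apply: hypo_tail_ge0 => //; first by move: us => /andP[].
  by move=> x xs; rewrite sw// inE xs orbT.
rewrite mulrN expRN => T0 T1.
rewrite mulrC -[leRHS]mul1r -ler_pdivrMr ?expR_gt0// mulrAC.
by rewrite (le_trans _ T1)// lerDr.
Qed.

(* Density at [t] at least that of the event that the partial sum over [s] lies
   in [t0, t] and the last exponential variable makes up the difference. *)
Lemma hypo_lb w a s t0 t : uniq (a :: s) -> (forall x, x \in a :: s -> x < w) ->
  0 <= t0 <= t ->
  expR (t * w) * ((w - a) * expR (- ((w - a) * (t - t0))) *
    (hypo_tail w s t0 - hypo_tail w s t))
  <= hypo (a :: s) t * \prod_(x <- a :: s) (w - x).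
Proof.
move=> us sw /andP[t00 t0t].
have us' : uniq s by move: us => /andP[].
have sw' x : x \in s -> x < w by move=> xs; rewrite sw// inE xs orbT.
have aw : 0 < w - a by rewrite subr_gt0 sw// mem_head.
pose r := w - a.
(* The derivative of [F] carries the factor e^(u r) - e^(t0 r), nonnegative for [u >= t0]. Comparing
   [F t0] with [F t] and dropping the density at [t0] gives the bound. *)
pose F u := expR (u * r) * hypo_density w (a :: s) u
   + r * expR (t0 * r) * hypo_tail w s u.
have dF (u : R) : is_derive u (1 : R) F
    (r * (expR (u * r) - expR (t0 * r)) * hypo_density w s u).
  have := is_derive_hypo_tail w s u us' => ?.
  have := is_derive_hypo_cons a s u us => ?.
  rewrite /F /hypo_density big_cons; apply: is_derive_eq.
  by rewrite /hypo_density /GRing.scale /= /r; ring.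
have dF0 u : t0 <= u ->
    0 <= r * (expR (u * r) - expR (t0 * r)) * hypo_density w s u.
  move=> ut0; rewrite mulr_ge0 ?hypo_density_ge0//; last exact: le_trans ut0.
  by rewrite mulr_ge0 ?(ltW aw)// subr_ge0 ler_expR ler_pM2r.
have h : r * expR (t0 * r) * (hypo_tail w s t0 - hypo_tail w s t) <=
    expR (t * r) * hypo_density w (a :: s) t.
  have g0 := hypo_density_ge0 w (a :: s) t0 us sw t00.
  have e0 := @mulr_ge0 _ _ _ (expR_ge0 (t0 * r)) g0.
  rewrite mulrBr lerBlDr; apply: le_trans (ger0_is_derive_le _ _ _ _ _ dF dF0 t0t).
  by rewrite /F lerDr.
have -> : hypo (a :: s) t * \prod_(x <- a :: s) (w - x) =
    expR (t * w) * hypo_density w (a :: s) t.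
  by rewrite /hypo_density mulrN expRN; field; rewrite gt_eqF ?expR_gt0.
rewrite ler_pM2l ?expR_gt0//.
rewrite (_ : - ((w - a) * (t - t0)) = t0 * r - t * r); last by rewrite /r; ring.
rewrite expRD expRN -(ler_pM2l (expR_gt0 (t * r))); apply: le_trans h.
rewrite le_eqVlt; apply/orP; left; apply/eqP; rewrite /r; field.
by rewrite gt_eqF ?expR_gt0.
Qed.

(* The tail and the right-hand side solve the same differential equation
   [T_(a::s)' = - (w - a) (T_(a::s) - T_s)]; compare initial values.  A negative
   [th] bounds the lower tail. *)
Lemma hypo_tail_chernoff w s th t : uniq s -> (forall x, x \in s -> x + th < w) ->
  (forall x, x \in s -> x < w) -> 0 <= t ->
  (if 0 <= th then hypo_tail w s t else 1 - hypo_tail w s t) <=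
  expR (t * - th) * \prod_(x <- s) ((w - x) / (w - x - th)).
Proof.
pose V s t := if 0 <= th then hypo_tail w s t else 1 - hypo_tail w s t.
pose P s := \prod_(x <- s) ((w - x) / (w - x - th)).
rewrite -/(V s t) -/(P s).
elim: s t => [|a s IH] t us swt sw t0.
  rewrite /V /P /= big_nil mulr1; case: ifPn => [_|]; first exact: expR_ge0.
  rewrite -ltNge subr0 => th0; rewrite -[leLHS]expR0 ler_expR mulr_ge0//.
  by rewrite oppr_ge0 ltW.
have us' : uniq s by move: us => /andP[].
have sw' x : x \in s -> x < w by move=> xs; rewrite sw// inE xs orbT.
have swt' x : x \in s -> x + th < w by move=> xs; rewrite swt// inE xs orbT.
have aw : 0 < w - a by rewrite subr_gt0 sw// mem_head.
have awt : 0 < w - a - th by rewrite -addrA -opprD subr_gt0 swt// mem_head.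
have PS : (w - a) * P s = P (a :: s) * (w - a - th).
  by rewrite /P big_cons; field; rewrite gt_eqF.
have P0 r : (forall x, x \in r -> x + th < w) -> (forall x, x \in r -> x < w) -> 0 <= P r.
  move=> h1 h2; rewrite /P big_seq prodr_ge0// => x xr.
  by have := h2 x xr; have := h1 x xr => *; apply: divr_ge0; lra.
have dV u r : uniq r -> is_derive u (1 : R) (V r)
    (if 0 <= th then - hypo_density w r u else hypo_density w r u).
  move=> /(is_derive_hypo_tail w r u) ?; rewrite /V.
  by case: ifPn => _ //; apply: is_derive_eq; rewrite /=; ring.
(* The integrating factor e^(u (w - a)) reduces the derivative of the difference to the inequality
   for [s], known by induction. *)
pose F u := expR (u * (w - a)) * (expR (u * - th) * P (a :: s) - V (a :: s) u).
have dF (u : R) : is_derive u (1 : R) F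
    ((w - a) * expR (u * (w - a)) * (expR (u * - th) * P s - V s u)).
  have := dV u _ us => ?.
  apply: is_derive_eq; rewrite /GRing.scale /=.
  rewrite [RHS](_ : _ = expR (u * (w - a)) *
    (expR (u * - th) * ((w - a) * P s) - (w - a) * V s u)); last by ring.
  rewrite PS.
  have := hypo_densityE w a s u; rewrite /V.
  by case: ifPn => _ ->; ring.
have dF0 u : 0 <= u ->
    0 <= (w - a) * expR (u * (w - a)) * (expR (u * - th) * P s - V s u).
  by move=> u0; rewrite mulr_ge0 ?subr_ge0 ?IH// mulr_ge0 ?expR_ge0// ltW.
rewrite -subr_ge0 -(pmulr_rge0 _ (expR_gt0 (t * (w - a)))).
apply: le_trans (ger0_is_derive_le _ _ _ _ _ dF dF0 t0).
rewrite /F !mul0r expR0 !mul1r subr_ge0 /V hypo_tail_at0//=.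
(* At time 0 the lower tail vanishes, while the upper tail is 1 and is dominated because each factor
   of the product is at least 1 for [th >= 0]. *)
case: ifPn => [th0|_]; last by rewrite subrr P0.
rewrite /P; elim: (a :: s) swt sw => [|b r IHr] h1 h2; first by rewrite big_nil.
have b0 : 0 < w - b - th by rewrite -addrA -opprD subr_gt0 h1// mem_head.
rewrite big_cons mulr_ege1 ?IHr//.
- by rewrite ler_pdivlMr// mul1r gerBl.
- by move=> x xr; rewrite h1// inE xr orbT.
- by move=> x xr; rewrite h2// inE xr orbT.
Qed.

End Hypoexponential.

(** * Large deviations *)

Section Asymptotics.
Context {R : realType}.
Implicit Types (s : seq R) (w x a t : R).

(** Each factor is 1 + th/(w - x - th), bounded by its exponential. The exponent is th/(w - x) plus
    th^2/((w - x)(w - x - th)), whose denominator is at least d^2/2. *)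
Lemma prod_tilt_le s (w d th : R) : 0 < d -> `|th| <= d / 2 ->
  (forall x, x \in s -> x + d <= w) ->
  \prod_(x <- s) ((w - x) / (w - x - th)) <=
  expR (th * (\sum_(x <- s) (w - x)^-1) + (size s)%:R * (2 * th ^+ 2 / d ^+ 2)).
Proof.
move=> d0 thd; elim: s => [|a s IH] sw.
  by rewrite !big_nil mulr0 mul0r addr0 expR0.
have aw : d <= w - a by rewrite lerBrDl sw// mem_head.
move: thd; rewrite ler_norml => /andP[th1 th2].
have at0 : d / 2 <= w - a - th by lra.
have at1 : 0 < w - a - th by lra.
have aw0 : 0 < w - a by lra.
rewrite !big_cons -[size (a :: s)]/(size s).+1 -natr1; set q := 2 * _ / _.
rewrite (_ : th * _ + _ = th / (w - a) + q +
  (th * (\sum_(x <- s) (w - x)^-1) + (size s)%:R * q)); last by ring.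
rewrite expRD ler_pM//.
- by apply: divr_ge0; lra.
- rewrite big_seq prodr_ge0// => x xs.
  have : x + d <= w by rewrite sw// inE xs orbT.
  by move=> ?; apply: divr_ge0; lra.
- rewrite (_ : _ / _ = 1 + th / (w - a - th)); last by field; rewrite gt_eqF.
  apply: le_trans (expR_ge1Dx _) _; rewrite ler_expR.
  have -> : th / (w - a - th) = th / (w - a) + th ^+ 2 / ((w - a) * (w - a - th)).
    by field; rewrite !gt_eqF.
  rewrite lerD2l /q -mulrA mulrCA ler_wpM2l ?sqr_ge0//.
  rewrite (_ : 2 / d ^+ 2 = (d * (d / 2))^-1); last by field; rewrite gt_eqF.
  have d20 : 0 < d / 2 by lra.
  by rewrite lef_pV2 ?posrE ?mulr_gt0//; apply: ler_pM; lra.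
- by apply: IH => x xs; rewrite sw// inE xs orbT.
Qed.

(** A weak law of large numbers: the sum concentrates near [N * m]. The first node is removed by
    [behead] because [hypo_lb] reserves its variable for filling the gap. *)
Lemma hypo_tail_eventually (X : nat -> seq R) w0 w m tau :
  (forall N, size (X N) = N) -> (forall N, uniq (X N)) ->
  (\forall N \near \oo, forall x, x \in X N -> x < w0) ->
  w0 < w -> (\sum_(x <- X N) (w - x)^-1) / N%:R @[N --> \oo] --> m ->
  0 <= tau -> m != tau ->
  \forall N \near \oo,
    (if m < tau then hypo_tail w (behead (X N)) (N%:R * tau)
     else 1 - hypo_tail w (behead (X N)) (N%:R * tau)) <= 4^-1.
Proof.
move=> sX uX Xw w0w Xm tau0 mtau.
pose d := w - w0; have d0 : 0 < d by rewrite subr_gt0.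
pose k := `|tau - m| / 2.
have k0 : 0 < k by rewrite divr_gt0// normr_gt0 subr_eq0 eq_sym.
(* The size of the tilt is such that the quadratic error 2 h^2/d^2 takes at most half of the linear
   gain [h * k]. *)
pose h := Num.min (d / 2) (d ^+ 2 * k / 4).
have h0 : 0 < h by rewrite lt_min !divr_gt0// mulr_gt0// exprn_gt0.
have hd : h <= d / 2 by rewrite ge_min lexx.
have hk : 2 * h ^+ 2 / d ^+ 2 <= h * k / 2.
  have : h <= d ^+ 2 * k / 4 by rewrite ge_min lexx orbT.
  rewrite ler_pdivrMr ?exprn_gt0// => hh.
  have := ler_wpM2l (ltW h0) hh; rewrite expr2; lra.
pose th := if m < tau then h else - h.
have nth : `|th| = h by rewrite /th; case: ifP => _; rewrite ?normrN gtr0_norm.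
have sth : (0 <= th) = (m < tau).
  by rewrite /th; case: ifP => _; rewrite ?(ltW h0)// oppr_ge0 leNgt h0.
near=> N.
have N0 : (0 < N)%N by near: N; exact: nbhs_infty_gt.
have NR : 0 < N%:R :> R by rewrite ltr0n.
have : forall x, x \in X N -> x < w0 by near: N.
have : `|m - (\sum_(x <- X N) (w - x)^-1) / N%:R| < k.
  by near: N; move/cvgrPdist_lt: Xm; exact.
(* The remaining gain [N * (h * k / 2)] pays [h / d] for the removed node and still leaves an
   exponent of at most -3, where e^3 >= 1 + 3 yields the bound 1/4. *)
have : (3 + h / d) / (h * k / 2) <= N%:R by near: N; exact: nbhs_infty_ger.
have hk0 : 0 < h * k := mulr_gt0 h0 k0.
rewrite ler_pdivrMr; last by lra.
move=> Nbig.
have := uX N; have := sX N; case: (X N) => [N0'|a s ss us Mk sw0].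
  by move: N0; rewrite -N0'.
rewrite /= -sth.
have sw x : x \in a :: s -> x + d <= w by move/sw0; rewrite /d; lra.
have us' : uniq s by move: us => /andP[].
apply: (le_trans (hypo_tail_chernoff w s th (N%:R * tau) us' _ _ _)).
- move=> x xs; have := sw x; rewrite inE xs orbT => /(_ isT).
  have := ler_norm th; rewrite nth; lra.
- move=> x xs; have := sw x; rewrite inE xs orbT => /(_ isT); lra.
- by rewrite mulr_ge0.
have := prod_tilt_le s w d th d0.
rewrite nth => /(_ hd) h1.
have {}h1 := h1 (fun x xs => sw x (mem_behead (s := a :: s) xs)).
apply: le_trans (ler_wpM2l (expR_ge0 _) h1) _.
rewrite -expRD.
set S := \sum_(x <- s) _ in h1 *.
set z := _ + _ .
suff : z <= - 3.
  move=> z3; rewrite -[z]opprK expRN lef_pV2 ?posrE ?expR_gt0//.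
  by apply: le_trans (expR_ge1Dx _); lra.
have aS : th * S <= th * (\sum_(x <- a :: s) (w - x)^-1) + h / d.
  rewrite big_cons mulrDr -/S addrAC lerDr -[h / d]opprK subr_ge0.
  have aw : 0 < (w - a)^-1 <= d^-1.
    have := sw a (mem_head _ _) => ?.
    have wa : 0 < w - a by lra.
    by rewrite invr_gt0 wa lef_pV2 ?posrE//; lra.
  rewrite -nth -mulNr.
  apply: (@le_trans _ _ (- `|th| / (w - a))).
    by rewrite ler_wnM2l ?oppr_le0//; case/andP: aw.
  rewrite ler_wpM2r//; first by case/andP: aw => /ltW.
  by rewrite lerNl -normrN ler_norm.
have kS : th * (\sum_(x <- a :: s) (w - x)^-1 - N%:R * tau) <= - (N%:R * h * k).
  move: Mk; set M := \sum_(x <- _) _ => Mk.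
  have ME : M = N%:R * (M / N%:R) by field; rewrite gt_eqF.
  rewrite {1}ME -mulrBr mulrCA -!mulrA -mulrN ler_pM2l//.
  move: Mk; set q := M / _; rewrite /k ltr_norml => /andP[q1 q2].
  rewrite -mulrN /th; case: ltP mtau => [mt _|].
    rewrite ler_pM2l//; move: q1 q2; rewrite gtr0_norm; lra.
  rewrite eq_sym le_eqVlt => /orP[->//|mt _].
  rewrite mulNr -mulrN ler_pM2l//; move: q1 q2; rewrite ltr0_norm; lra.
have sN : (size s)%:R <= N%:R :> R by rewrite ler_nat -ss.
have zz : (size s)%:R * (2 * th ^+ 2 / d ^+ 2) <= N%:R * (h * k / 2).
  have -> : th ^+ 2 = h ^+ 2 by rewrite /th; case: ifP => _; rewrite ?sqrrN.
  apply: ler_pM => //.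
  by apply: divr_ge0; [apply: mulr_ge0; rewrite ?sqr_ge0|exact: sqr_ge0].
rewrite /z; move: kS zz aS Nbig; rewrite mulrBr.
have -> : N%:R * tau * - th = - (th * (N%:R * tau)) by ring.
have -> : N%:R * h * k = 2 * (N%:R * (h * k / 2)) by field.
lra.
Unshelve. all: by end_near. Qed.

Lemma ln_prod (I : eqType) (r : seq I) (g : I -> R) :
  (forall i, i \in r -> 0 < g i) ->
  ln (\prod_(i <- r) g i) = \sum_(i <- r) ln (g i).
Proof.
elim: r => [|a r IH] g0; first by rewrite !big_nil ln1.
have g0' i : i \in r -> 0 < g i by move=> ir; rewrite g0// inE ir orbT.
rewrite !big_cons lnM ?IH// posrE ?g0 ?mem_head//.
by rewrite big_seq prodr_gt0.
Qed.

(** Logarithms of [hypo_lb] and [hypo_ub]. The term [d / 2] is the least rate times the probability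
    1/2, and [K * (t - t0)] is the cost of filling the gap with one variable of rate at most [K]. *)
Lemma hypo_ln_bounds w s d K (t0 t : R) : uniq s -> s != [::] -> 0 < d ->
  (forall x, x \in s -> d <= w - x <= K) -> 0 <= t0 <= t ->
  2^-1 <= hypo_tail w (behead s) t0 - hypo_tail w (behead s) t ->
  t * w - \sum_(x <- s) ln (w - x) + (ln (d / 2) - K * (t - t0))
  <= ln (hypo s t) <= t * w - \sum_(x <- s) ln (w - x) + K.
Proof.
case: s => [//|a s] us _ d0 sd /andP[t00 t0t] /= T.
have sw x : x \in a :: s -> x < w by move=> /sd /andP[]; lra.
have /andP[da aK] := sd a (mem_head _ _).
have wa : 0 < w - a by lra.
have -> : \sum_(x <- a :: s) ln (w - x) = ln (\prod_(x <- a :: s) (w - x)).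
  by rewrite ln_prod// => x xs; rewrite subr_gt0 sw.
have P0 : 0 < \prod_(x <- s) (w - x).
  by rewrite big_seq prodr_gt0// => x xs; rewrite subr_gt0 sw// inE xs orbT.
have P1 : 0 < \prod_(x <- a :: s) (w - x) by rewrite big_cons mulr_gt0.
have lb : expR (t * w) * (d / 2 * expR (- (K * (t - t0)))) <=
    hypo (a :: s) t * \prod_(x <- a :: s) (w - x).
  apply: le_trans (hypo_lb w a s t0 t us sw _); last by rewrite t00.
  rewrite ler_pM2l ?expR_gt0// [d / 2 * _]mulrAC ler_pM ?mulr_ge0 ?expR_ge0 ?(ltW d0)//.
  apply: ler_pM; rewrite ?expR_ge0 ?(ltW d0)// ler_expR lerN2 ler_wpM2r//.
  by rewrite subr_ge0.
have h0 : 0 < hypo (a :: s) t.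
  rewrite -(pmulr_lgt0 _ P1); apply: lt_le_trans lb.
  by rewrite !mulr_gt0 ?expR_gt0// divr_gt0.
apply/andP; split.
- rewrite addrAC lerBlDr -lnM ?posrE//.
  rewrite -ler_expR lnK ?posrE ?mulr_gt0//; apply: le_trans lb.
  by rewrite expRD expRD lnK ?posrE ?divr_gt0.
- have t0' : 0 <= t by exact: le_trans t0t.
  have := hypo_ub w a s t us sw t0'.
  rewrite -ler_ln ?posrE ?mulr_gt0 ?expR_gt0// lnM ?posrE// expRK big_cons lnM ?posrE//.
  have := @le_ln1Dx R (w - a - 1).
  rewrite addrCA subrr addr0 => lna.
  have {}lna : ln (w - a) <= w - a - 1 by apply: lna; lra.
  lra.
Qed.

(** For [w] slightly above [w0] the limiting mean [M w] lies in the window from [y - eps] to [y].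
    The partial sum divided by [N] then falls there with probability at least 1/2, and the last
    variable covers at most [N * eps]. *)
Lemma hypo_asymptotic (X : nat -> seq R) (y w0 K : R) (F M : R -> R) :
  0 < y -> 0 <= K -> (forall N, size (X N) = N) -> (forall N, uniq (X N)) ->
  (\forall N \near \oo, forall x, x \in X N -> x < w0) ->
  (forall N x, x \in X N -> w0 - K <= x) ->
  (forall w, w0 < w -> (\sum_(x <- X N) ln (w - x)) / N%:R @[N --> \oo] --> F w) ->
  (forall w, w0 < w -> (\sum_(x <- X N) (w - x)^-1) / N%:R @[N --> \oo] --> M w) ->
  (forall w, w0 < w -> M w < y) ->
  F w @[w --> w0^'+] --> F w0 -> M w @[w --> w0^'+] --> y ->
  ln (hypo (X N) (N%:R * y)) / N%:R @[N --> \oo] --> y * w0 - F w0.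
Proof.
move=> y0 K0 sX uX Xw XK cF cM My F0 M0.
apply/cvgrPdist_lt => e e0.
(* For [w < w0 + 1] the rates are at most [K + 1], so covering the gap costs at most [e / 3] per
   unit of [N]; [eps <= y] keeps the window nonnegative. *)
pose eps := Num.min y (e / (3 * (K + 1))).
have K1 : 0 < K + 1 by lra.
have eps0 : 0 < eps by rewrite lt_min y0 divr_gt0// mulr_gt0.
have epsy : eps <= y by rewrite ge_min lexx.
have epsK : (K + 1) * eps <= e / 3.
  have : eps <= e / (3 * (K + 1)) by rewrite ge_min lexx orbT.
  by rewrite ler_pdivlMr ?mulr_gt0//; lra.
have [w [w0w ww1 Fw Mw]] : exists w, [/\ w0 < w, w < w0 + 1,
    `|y * w0 - F w0 - (y * w - F w)| < e / 3 & y - eps < M w].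
  near (w0^'+) => w; exists w; split; near: w.
  - exact: nbhs_right_gt.
  - by apply: nbhs_right_lt; rewrite ltrDl.
  - have : y * w - F w @[w --> w0^'+] --> y * w0 - F w0.
      apply: cvgB => //; apply: cvgM; first exact: cvg_cst.
      by apply: cvg_at_right_filter; exact: cvg_id.
    by move/cvgrPdist_lt; apply; rewrite divr_gt0.
  - by apply: (cvgr_gt y M0); rewrite ltrBlDr ltrDl.
have d0 : 0 < w - w0 by rewrite subr_gt0.
have MwN := My w w0w.
have y1 : 0 <= y - eps by rewrite subr_ge0.
(* The mean lies strictly between the two times; each tail estimate loses at most 1/4, which leaves
   1/2. *)
have T0 := hypo_tail_eventually X w0 w (M w) (y - eps) sX uX Xw w0w (cM w w0w) y1.
have T1 := hypo_tail_eventually X w0 w (M w) y sX uX Xw w0w (cM w w0w) (ltW y0).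
near=> N.
have N0 : (0 < N)%N by near: N; exact: nbhs_infty_gt.
have NR : 0 < N%:R :> R by rewrite ltr0n.
have XN : forall x, x \in X N -> x < w0 by near: N.
have : hypo_tail w (behead (X N)) (N%:R * y) <= 4^-1.
  by near: N; have := T1 (negbT (lt_eqF MwN)); rewrite MwN.
have : 1 - hypo_tail w (behead (X N)) (N%:R * (y - eps)) <= 4^-1.
  near: N; have := T0 (negbT (gt_eqF Mw)); apply: filterS => n.
  by rewrite ltNge (ltW Mw).
move=> t0 t1.
have FN : `|F w - (\sum_(x <- X N) ln (w - x)) / N%:R| < e / 9.
  by near: N; move/cvgrPdist_lt: (cF w w0w); apply; rewrite divr_gt0.
have KN : (K + 1) / (e / 9) < N%:R by near: N; exact: nbhs_infty_gtr.
have lnN : `|ln ((w - w0) / 2)| / (e / 9) < N%:R.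
  by near: N; exact: nbhs_infty_gtr.
have Xne : X N != [::] by rewrite -size_eq0 sX -lt0n.
have Xd x : x \in X N -> w - w0 <= w - x <= K + 1.
  by move=> xX; move: (XN x xX) (XK N x xX) (w0w) (ww1); clear; lra.
have tt : 0 <= N%:R * (y - eps) <= N%:R * y.
  by rewrite mulr_ge0//= ler_pM2l// gerBl ltW.
have := hypo_ln_bounds w (X N) (w - w0) (K + 1) _ _ (uX N) Xne d0 Xd tt.
have th : 2^-1 <= hypo_tail w (behead (X N)) (N%:R * (y - eps)) -
    hypo_tail w (behead (X N)) (N%:R * y).
  by move: (t0) (t1); clear; lra.
move=> /(_ th); set H := ln (hypo _ _); set S := \sum_(_ <- _) _ in FN *.
move=> hb.
have e9 : 0 < e / 9 by rewrite divr_gt0.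
move: KN lnN; rewrite !ltr_pdivrMr// => KN lnN.
have HE : H = N%:R * (H / N%:R) by field; rewrite gt_eqF.
have SE : S = N%:R * (S / N%:R) by field; rewrite gt_eqF.
move: hb FN; rewrite {1 2}HE {1 2}SE.
set h := H / _; set q := S / _.
have -> : N%:R * y - N%:R * (y - eps) = N%:R * eps by ring.
have lnN' := ler_norm (- ln ((w - w0) / 2)); rewrite normrN in lnN'.
have NK : (K + 1) * (N%:R * eps) <= N%:R * (e / 3).
  by rewrite mulrCA ler_pM2l.
move=> /andP[lo hi]; rewrite ltr_norml => /andP[q1 q2].
have lo' : N%:R * (y * w - q - e / 9 - e / 3) < N%:R * h.
  by move: (lo) (lnN) (lnN') (NK); clear; lra.
have hi' : N%:R * h < N%:R * (y * w - q + e / 9).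
  by move: (hi) (KN); clear; lra.
rewrite ltr_pM2l// in lo'; rewrite ltr_pM2l// in hi'.
move: Fw; rewrite ltr_norml => /andP[f1 f2].
rewrite ltr_norml; apply/andP.
by split; move: (f1) (f2) (lo') (hi') (q1) (q2) (e0); clear; lra.
Unshelve. all: by end_near. Qed.

End Asymptotics.

(** * Riemann sums of monotone functions *)

Section Riemann.
Context {R : realType}.
Implicit Types (g : R -> R).
Local Notation mu := (@lebesgue_measure R).

Lemma nondecreasing01_integrable g : {in `[0, 1] &, nondecreasing_fun g} ->
  mu.-integrable `[0, 1] (EFin \o g).
Proof.
move=> gn.
(* Clamping to the unit interval extends [g] to a monotone, hence measurable, function on the
   line. *)
pose c (x : R) : R := Num.max 0 (Num.min x 1).
have cP x : c x \in `[0, 1].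
  by rewrite in_itv /= /c le_max lexx /= ge_max ler01 /= ge_min lexx orbT.
have cE x : x \in `[0, 1] -> c x = x.
  rewrite in_itv /= => /andP[x0 x1]; rewrite /c.
  by rewrite min_l// max_r.
have gc : nondecreasing_fun (g \o c).
  move=> x y xy /=; apply: gn => //.
  rewrite /c ge_max le_max lexx /= le_max; apply/orP; right.
  by rewrite le_min !ge_min xy lexx orbT.
apply: measurable_bounded_integrable => //.
- by rewrite /= lebesgue_measure_itv /= lte_fin ltr01 oppr0 adde0 ltry.
- apply: (@eq_measurable_fun _ _ _ _ _ (g \o c)).
    by move=> x; rewrite inE => /= x01; rewrite /= cE.
  exact: nondecreasing_measurable.
- exists (Num.max `|g 0| `|g 1|); split; first by rewrite num_real.
  move=> x xM t /= t01; apply: le_trans (ltW xM).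
  have h0 : g 0 <= g t.
    by apply: gn => //; rewrite ?in_itv /= ?lexx ?ler01//; case/andP: t01.
  have h1 : g t <= g 1.
    by apply: gn => //; rewrite ?in_itv /= ?lexx ?ler01//; case/andP: t01.
  rewrite le_max; case: (lerP 0 (g t)) => gt0.
    by rewrite orbC ger0_norm ?(le_trans h1 (ler_norm _)).
  by rewrite ltr0_norm// (ler0_norm (ltW (le_lt_trans h0 gt0))) lerN2 h0.
Qed.

(** The integral lies between the left and right sums, whose difference telescopes. *)
Lemma riemann_nondecreasing g N : {in `[0, 1] &, nondecreasing_fun g} ->
  (0 < N)%N ->
  `|(\sum_(i < N) g (i.+1%:R / N%:R)) / N%:R -
    \int[mu]_(t in `[0, 1]) g t| <= (g 1 - g 0) / N%:R.
Proof.
move=> gn N0; have ig := nondecreasing01_integrable g gn.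
have NR : 0 < N%:R :> R by rewrite ltr0n.
have step k : (k <= N)%N ->
  (\sum_(i < k) g (i%:R / N%:R)) / N%:R <=
  \int[mu]_(t in `[0, k%:R / N%:R]) g t <=
  (\sum_(i < k) g (i.+1%:R / N%:R)) / N%:R.
  elim: k => [_|k IH kN].
    by rewrite !big_ord0 !mul0r set_itv1 Rintegral_set1 lexx.
  have /andP[l u] := IH (ltnW kN).
  pose p : R := k%:R / N%:R; pose q : R := k.+1%:R / N%:R.
  have p0 : 0 <= p by rewrite divr_ge0.
  have pq : p < q by rewrite ltr_pM2r ?invr_gt0// ltr_nat.
  have q1 : q <= 1 by rewrite ler_pdivrMr// mul1r ler_nat.
  have qp : q - p = N%:R^-1.
    by rewrite /q /p -mulrBl -natr1 addrAC subrr add0r mul1r.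
  have i0q : mu.-integrable `[0, q] (EFin \o g).
    by apply: integrableS ig => //; apply: subset_itvl; rewrite bnd_simp.
  have ipq : mu.-integrable `]p, q] (EFin \o g).
    by apply: integrableS i0q => //; apply: subset_itvr; rewrite bnd_simp.
  have E : \int[mu]_(t in `[0, q]) g t = \int[mu]_(t in `[0, p]) g t +
      \int[mu]_(t in `]p, q]) g t.
    have := @Rintegral_itvB R g (BLeft 0) (BRight q) p i0q.
    by rewrite !bnd_simp => <- //; [rewrite addrC subrK|exact: ltW].
  have icst r : mu.-integrable `]p, q] (EFin \o cst r).
    apply: (@integrableS _ _ _ mu `[0, 1]) => //.
      by apply: subset_itv; rewrite bnd_simp.
    by apply: nondecreasing01_integrable => x y _ _ _ /=.
  have cst_int r : \int[mu]_(t in `]p, q]) (cst r) t = r / N%:R.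
    rewrite Rintegral_cst//= lebesgue_measure_itv /= lte_fin pq /=.
    by rewrite qp.
  have pin : p \in `[0, 1] by rewrite in_itv /= p0 (le_trans (ltW pq)).
  have qin : q \in `[0, 1] by rewrite in_itv /= q1 (le_trans p0 (ltW pq)).
  have xin x : x \in `]p, q] -> x \in `[0, 1].
    rewrite !in_itv /= => /andP[px xq].
    by rewrite (le_trans p0 (ltW px)) (le_trans xq).
  rewrite !big_ord_recr /= !mulrDl E; apply/andP; split; apply: lerD => //.
  - rewrite -/p -cst_int; apply: le_Rintegral => // x /= xpq.
    apply: gn => //; first exact: xin.
    by move: xpq; rewrite in_itv /= => /andP[/ltW].
  - rewrite -/q -cst_int; apply: le_Rintegral => // x /= xpq.
    apply: gn => //; first exact: xin.
    by move: xpq; rewrite in_itv /= => /andP[].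
have := step N (leqnn N); rewrite divff ?gt_eqF// => /andP[l u].
rewrite ger0_norm ?subr_ge0//.
have tele : \sum_(i < N) g (i.+1%:R / N%:R) - \sum_(i < N) g (i%:R / N%:R) =
   g 1 - g 0.
  rewrite -sumrB -(big_mkord xpredT (fun i => g (i.+1%:R / N%:R) - g (i%:R / N%:R))).
  by rewrite telescope_sumr// divff ?gt_eqF// mul0r.
by rewrite -tele mulrBl lerB.
Qed.

Definition monotone01 g := {in `[0, 1] &, nondecreasing_fun g} \/
  {in `[0, 1] &, nonincreasing_fun g}.

Lemma monotone01_integrable g : monotone01 g -> mu.-integrable `[0, 1] (EFin \o g).
Proof.
case=> [|gn]; first exact: nondecreasing01_integrable.
have : mu.-integrable `[0, 1] (EFin \o (\- g)).
  by apply: nondecreasing01_integrable => x y x0 y0 xy; rewrite lerN2 gn.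
move=> /integrableN; apply: eq_integrable => // x _ /=.
by rewrite opprK.
Qed.

Lemma cvg_riemann_sum g (a : forall N, 'I_N -> R) : monotone01 g ->
  (\sum_(i < N) `|a N i - g (i.+1%:R / N%:R)|) / N%:R @[N --> \oo] --> (0 : R) ->
  (\sum_(i < N) a N i) / N%:R @[N --> \oo] --> \int[mu]_(t in `[0, 1]) g t.
Proof.
move=> gm a0.
have bound N : (0 < N)%N -> `|(\sum_(i < N) g (i.+1%:R / N%:R)) / N%:R -
    \int[mu]_(t in `[0, 1]) g t| <= `|g 1 - g 0| / N%:R.
  move=> N0; case: (gm) => gn.
    apply: le_trans (riemann_nondecreasing g N gn N0) _.
    by rewrite ler_pM2r ?invr_gt0 ?ltr0n// ler_norm.
  have gn' : {in `[0, 1] &, nondecreasing_fun (\- g)}.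
    by move=> x y x0 y0 xy; rewrite lerN2 gn.
  have := riemann_nondecreasing (\- g) N gn' N0.
  have -> : \int[mu]_(t in `[0, 1]) (\- g) t = - \int[mu]_(t in `[0, 1]) g t.
    rewrite -mulN1r -RintegralZl//; last exact: monotone01_integrable.
    by apply: eq_Rintegral => t _; rewrite mulN1r.
  rewrite sumrN mulNr -opprD normrN => /le_trans; apply.
  by rewrite ler_pM2r ?invr_gt0 ?ltr0n// -normrN opprB opprK addrC ler_norm.
apply/cvgrPdist_lt => e e0.
near=> N.
have N0 : (0 < N)%N by near: N; exact: nbhs_infty_gt.
have NR : 0 < N%:R :> R by rewrite ltr0n.
have aN : (\sum_(i < N) `|a N i - g (i.+1%:R / N%:R)|) / N%:R < e / 2.
  by near: N; apply: (cvgr_lt 0 a0); rewrite divr_gt0.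
have : `|g 1 - g 0| / (e / 2) < N%:R by near: N; exact: nbhs_infty_gtr.
rewrite ltr_pdivrMr ?divr_gt0// mulrC -ltr_pdivrMr// => /(le_lt_trans (bound N N0)) bN.
have : `|(\sum_(i < N) a N i) / N%:R - (\sum_(i < N) g (i.+1%:R / N%:R)) / N%:R|
   < e / 2.
  apply: le_lt_trans aN; rewrite -mulrBl -sumrB normrM [`|_^-1|]gtr0_norm ?invr_gt0//.
  by rewrite ler_pM2r ?invr_gt0// ler_norm_sum.
rewrite distrC => h.
apply: le_lt_trans (ler_distD ((\sum_(i < N) g (i.+1%:R / N%:R)) / N%:R) _ _) _.
by rewrite [e]splitr ltrD// distrC.
Unshelve. all: by end_near. Qed.

End Riemann.

(** * Limit profiles *)

Section Profile.
Context {R : realType}.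
Implicit Types (phi g : R -> R) (w : R).
Local Notation mu := (@lebesgue_measure R).

Lemma Rintegral01_leD g1 g2 (k : R) : monotone01 g1 -> monotone01 g2 ->
  (forall t, t \in `[0, 1] -> g1 t + k <= g2 t) ->
  \int[mu]_(t in `[0, 1]) g1 t + k <= \int[mu]_(t in `[0, 1]) g2 t.
Proof.
move=> m1 m2 g12.
have kc : monotone01 (cst k) by left => x y _ _ _ /=.
have <- : \int[mu]_(t in `[0, 1]) (cst k) t = k.
  by rewrite Rintegral_cst//= lebesgue_measure_itv /= lte_fin ltr01 oppr0 adde0 mulr1.
rewrite -RintegralD//; try exact: monotone01_integrable.
apply: le_Rintegral => //; try exact: monotone01_integrable.
have := integrableD _ (monotone01_integrable _ m1) (monotone01_integrable _ kc).
by move=> /(_ (measurable_itv _)).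
Qed.

Lemma monotone01_comp phi (h : R -> R) (D : set R) :
  monotone01 phi -> (forall t, t \in `[0, 1] -> D (phi t)) ->
  (forall x y, D x -> D y -> x <= y -> h y <= h x) ->
  monotone01 (h \o phi).
Proof.
move=> [m|m] D0 hd; [right|left] => x y x0 y0 xy /=.
- by apply: hd; [exact: D0|exact: D0|exact: m].
- by apply: hd; [exact: D0|exact: D0|exact: m].
Qed.

Lemma monotone01_ln phi w : monotone01 phi ->
  (forall t, t \in `[0, 1] -> phi t < w) -> monotone01 (fun t => ln (w - phi t)).
Proof.
move=> m pw; apply: (monotone01_comp phi (fun x => ln (w - x)) [set x | x < w]) => //.
by move=> x y /= xw yw xy; rewrite ler_ln ?posrE ?subr_gt0// lerD2l lerN2.
Qed.

Lemma monotone01_inv phi w : monotone01 phi ->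
  (forall t, t \in `[0, 1] -> phi t < w) -> monotone01 (fun t => (w - phi t)^-1).
Proof.
move=> m pw.
have : monotone01 ((fun x => - (w - x)^-1) \o phi).
  apply: (monotone01_comp phi _ [set x | x < w]) => //.
  move=> x y /= xw yw xy; rewrite lerN2 lef_pV2 ?posrE ?subr_gt0//.
  by rewrite lerD2l lerN2.
by case=> mm; [right|left] => x y x0 y0 xy; rewrite -lerN2; exact: mm.
Qed.

Lemma ln_lipschitz (d u v : R) : 0 < d -> d <= u -> d <= v ->
  `|ln u - ln v| <= d^-1 * `|u - v|.
Proof.
move=> d0; wlog uv : u v / v <= u => [H du dv|du dv].
  by case/orP: (le_total v u) => uv; [|rewrite distrC [`|u - v|]distrC]; exact: H.
have v0 : 0 < v by exact: lt_le_trans dv.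
have u0 : 0 < u by exact: lt_le_trans du.
rewrite !ger0_norm ?subr_ge0 ?ler_ln//.
have -> : ln u - ln v = ln (1 + (u - v) / v).
  by rewrite -ln_div ?posrE//; congr ln; field; rewrite gt_eqF.
apply: le_trans (le_ln1Dx _) _.
  by rewrite (@lt_le_trans _ _ 0)// divr_ge0 ?subr_ge0// ltW.
by rewrite mulrC ler_wpM2r ?subr_ge0// lef_pV2 ?posrE.
Qed.

Lemma inv_lipschitz (d u v : R) : 0 < d -> d <= u -> d <= v ->
  `|u^-1 - v^-1| <= d ^- 2 * `|u - v|.
Proof.
move=> d0 du dv.
have v0 : 0 < v by exact: lt_le_trans dv.
have u0 : 0 < u by exact: lt_le_trans du.
have -> : u^-1 - v^-1 = (v - u) / (u * v) by field; rewrite !gt_eqF.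
rewrite normrM distrC mulrC ler_wpM2r// gtr0_norm ?invr_gt0 ?mulr_gt0//.
by rewrite lef_pV2 ?posrE ?mulr_gt0 ?exprn_gt0// expr2; apply: ler_pM => //; exact: ltW.
Qed.

(** The Lipschitz bound below [w0] transfers the averaged closeness of nodes and profile to their
    images under [h]; the rest is a Riemann sum. *)
Lemma cvg_profile_sum phi (x : forall N, 'I_N -> R) (h : R -> R) (w0 L : R) :
  monotone01 (h \o phi) -> (forall t, t \in `[0, 1] -> phi t < w0) -> 0 <= L ->
  (forall u v, u < w0 -> v < w0 -> `|h u - h v| <= L * `|u - v|) ->
  (\forall N \near \oo, forall i, x N i < w0) ->
  (\sum_(i < N) `|x N i - phi (i.+1%:R / N%:R)|) / N%:R @[N --> \oo] --> (0 : R) ->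
  (\sum_(i < N) h (x N i)) / N%:R @[N --> \oo] --> \int[mu]_(t in `[0, 1]) h (phi t).
Proof.
move=> hm pw L0 hL xw x0.
apply: (cvg_riemann_sum (h \o phi) (fun N i => h (x N i)) hm).
have Lx : L * ((\sum_(i < N) `|x N i - phi (i.+1%:R / N%:R)|) / N%:R)
    @[N --> \oo] --> (0 : R).
  by rewrite -[X in _ --> X](mulr0 L); apply: cvgM => //; exact: cvg_cst.
apply: (squeeze_cvgr _ (cvg_cst 0) Lx).
near=> N; apply/andP; split.
  by rewrite divr_ge0// sumr_ge0.
rewrite mulrA ler_wpM2r ?invr_ge0// mulr_sumr ler_sum// => i _ /=.
have N0 : (0 < N)%N by exact: leq_ltn_trans (ltn_ord i).
apply: hL; last first.
  apply: pw; rewrite in_itv /= divr_ge0//= ler_pdivrMr ?ltr0n// mul1r.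
  by rewrite ler_nat.
by move: i; near: N.
Unshelve. all: by end_near. Qed.

Lemma hypo_profile_asymptotic phi (x : forall N, 'I_N -> R) (y w0 : R) :
  0 < y -> monotone01 phi -> (forall t, t \in `[0, 1] -> phi t < w0) ->
  \int[mu]_(t in `[0, 1]) (w0 - phi t)^-1 = y ->
  (forall N, injective (x N)) ->
  (exists K, forall N i, K <= x N i) ->
  (\forall N \near \oo, forall i, x N i < w0) ->
  (\sum_(i < N) `|x N i - phi (i.+1%:R / N%:R)|) / N%:R @[N --> \oo] --> (0 : R) ->
  ln (hypo [seq x N i | i <- enum 'I_N] (N%:R * y)) / N%:R @[N --> \oo] -->
  y * w0 - \int[mu]_(t in `[0, 1]) ln (w0 - phi t).
Proof.
move=> y0 pm pw yE xI [K xK] xw x0.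
have sumE N (g : R -> R) :
    \sum_(z <- [seq x N i | i <- enum 'I_N]) g z = \sum_(i < N) g (x N i).
  by rewrite big_map big_enum.
have in0 : (0 : R) \in `[0, 1] by rewrite in_itv /= lexx ler01.
have in1 : (1 : R) \in `[0, 1] by rewrite in_itv /= lexx ler01.
pose pM := Num.max (phi 0) (phi 1).
pose pm0 := Num.min (phi 0) (phi 1).
have pb t : t \in `[0, 1] -> pm0 <= phi t <= pM.
  move=> t01; have := t01; rewrite in_itv /= => /andP[t0 t1].
  rewrite /pm0 /pM ge_min le_max.
  by case: pm => m; rewrite !(m _ _ _ _ t0) ?(m _ _ _ _ t1) ?orbT.
have pMw : pM < w0 by rewrite gt_max !pw.
(* Extremes of a monotone profile are attained at the endpoints, so the profile stays at distance
   [c] from [w0]. This makes both integrals Lipschitz in [w] to the right of [w0]. *)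
pose c := w0 - pM; have c0 : 0 < c by rewrite subr_gt0.
pose C := w0 - pm0.
have cb t : t \in `[0, 1] -> c <= w0 - phi t <= C.
  by move=> /pb /andP[? ?]; rewrite !lerD2l !lerN2; apply/andP.
have C0 : 0 < C by have /andP[] := cb _ in0; lra.
have pw' w t : w0 < w -> t \in `[0, 1] -> phi t < w.
  by move=> w0w /pw /lt_trans; exact.
have mln w : w0 <= w -> monotone01 (fun t => ln (w - phi t)).
  by move=> w0w; apply: monotone01_ln => // t /pw /lt_le_trans; exact.
have minv w : w0 <= w -> monotone01 (fun t => (w - phi t)^-1).
  by move=> w0w; apply: monotone01_inv => // t /pw /lt_le_trans; exact.
have squeeze (G : R -> R) (k : R) : 0 <= k ->
    (forall w, w0 < w -> `|G w0 - G w| <= k * (w - w0)) ->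
    G w @[w --> w0^'+] --> G w0.
  move=> k0 H; have kk : 0 < k + 1 by rewrite ltr_wpDl.
  apply/cvgrPdist_lt => e e0; near=> w.
  have w0w : w0 < w by near: w; exact: nbhs_right_gt.
  apply: le_lt_trans (H _ w0w) _.
  have : w - w0 < e / (k + 1).
    by near: w; apply: nbhs_right_ltDr; rewrite divr_gt0.
  rewrite ltr_pdivlMr// mulrDr mulr1 => /(le_lt_trans _); apply.
  by rewrite mulrC lerDl subr_ge0 ltW.
apply: (hypo_asymptotic (fun N => [seq x N i | i <- enum 'I_N]) y w0 (Num.max 0 (w0 - K))
  (fun w => \int[mu]_(t in `[0, 1]) ln (w - phi t))
  (fun w => \int[mu]_(t in `[0, 1]) (w - phi t)^-1)) => //.
- by rewrite le_max lexx.
- by move=> N; rewrite size_map size_enum_ord.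
- by move=> N; rewrite map_inj_uniq ?enum_uniq//; exact: xI.
- by apply: filterS xw => N xN z /mapP[i _ ->].
- move=> N z /mapP[i _ ->]; apply: le_trans (xK N i).
  by rewrite lerBlDr -lerBlDl le_max lexx orbT.
- move=> w w0w; under eq_fun do rewrite sumE.
  have d0 : 0 < w - w0 by rewrite subr_gt0.
  apply: (cvg_profile_sum phi x (fun z => ln (w - z)) w0 (w - w0)^-1) => //.
  + exact: mln (ltW w0w).
  + by rewrite invr_ge0 ltW.
  + move=> u v uw vw; have -> : `|u - v| = `|(w - u) - (w - v)|.
      by rewrite distrC; congr (`|_|); ring.
    by apply: ln_lipschitz => //; rewrite lerD2l lerN2 ltW.
- move=> w w0w; under eq_fun do rewrite sumE.
  have d0 : 0 < w - w0 by rewrite subr_gt0.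
  apply: (cvg_profile_sum phi x (fun z => (w - z)^-1) w0 ((w - w0) ^- 2)) => //.
  + exact: minv (ltW w0w).
  + by rewrite invr_ge0 sqr_ge0.
  + move=> u v uw vw; have -> : `|u - v| = `|(w - u) - (w - v)|.
      by rewrite distrC; congr (`|_|); ring.
    by apply: inv_lipschitz => //; rewrite lerD2l lerN2 ltW.
- move=> w w0w; rewrite -yE.
  have d0 : 0 < w - w0 by rewrite subr_gt0.
  have Cw : 0 < C + (w - w0) by lra.
  (* A uniform lower bound for the pointwise drop of the inverse between [w0] and [w], which makes
     the drop of the mean strict. *)
  pose k := (w - w0) / (C * (C + (w - w0))).
  have k0 : 0 < k by rewrite divr_gt0// mulr_gt0.
  apply: (@lt_le_trans _ _ (\int[mu]_(t in `[0, 1]) (w - phi t)^-1 + k)).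
    by rewrite ltrDl.
  apply: Rintegral01_leD; [exact: minv (ltW w0w)|exact: minv|].
  move=> t t01; have /andP[ct tC] := cb t t01.
  rewrite -lerBrDl /k.
  have p0 : 0 < w0 - phi t by exact: lt_le_trans ct.
  have p1 : 0 < w - phi t by lra.
  have -> : (w0 - phi t)^-1 - (w - phi t)^-1 =
      (w - w0) / ((w0 - phi t) * (w - phi t)) by field; rewrite !gt_eqF.
  rewrite ler_wpM2l ?(ltW d0)// lef_pV2 ?posrE ?mulr_gt0//.
  by apply: ler_pM; move: (p0) (p1) (tC) => *; lra.
- apply: (squeeze _ c^-1); first by rewrite invr_ge0 ltW.
  move=> w w0w; have key t : t \in `[0, 1] ->
      `|ln (w0 - phi t) - ln (w - phi t)| <= c^-1 * (w - w0).
    move=> t01; have /andP[ct tC] := cb t t01.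
    apply: le_trans (ln_lipschitz c _ _ c0 ct _) _; first by lra.
    rewrite ler_wpM2l ?invr_ge0 ?(ltW c0)//.
    by rewrite distrC ger0_norm; lra.
  rewrite ler_norml; apply/andP; split.
  + rewrite lerBrDr [_ + _]addrC; apply: Rintegral01_leD => [||t /key].
      exact: mln (ltW w0w). exact: mln.
    by rewrite ler_norml => /andP[? ?]; lra.
  + rewrite lerBlDl -lerBlDr; apply: Rintegral01_leD => [||t /key].
      exact: mln. exact: mln (ltW w0w).
    by rewrite ler_norml => /andP[? ?]; lra.
- rewrite -yE; apply: (squeeze (fun w => \int[mu]_(t in `[0, 1]) (w - phi t)^-1)
    (c ^- 2)); first by rewrite invr_ge0 sqr_ge0.
  move=> w w0w; have key t : t \in `[0, 1] ->
      `|(w0 - phi t)^-1 - (w - phi t)^-1| <= c ^- 2 * (w - w0).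
    move=> t01; have /andP[ct tC] := cb t t01.
    apply: le_trans (inv_lipschitz c _ _ c0 ct _) _; first by lra.
    rewrite ler_wpM2l ?invr_ge0 ?sqr_ge0//.
    by rewrite distrC ger0_norm; lra.
  rewrite ler_norml; apply/andP; split.
  + rewrite lerBrDr [_ + _]addrC; apply: Rintegral01_leD => [||t /key].
      exact: minv (ltW w0w). exact: minv.
    by rewrite ler_norml => /andP[? ?]; lra.
  + rewrite lerBlDl -lerBlDr; apply: Rintegral01_leD => [||t /key].
      exact: minv. exact: minv (ltW w0w).
    by rewrite ler_norml => /andP[? ?]; lra.
Unshelve. all: by end_near. Qed.

(** A crude Stirling estimate for (N - 1)! with N = n + 1, by induction from 1/(m + 2) <= ln(1 +
    1/(m + 1)) <= 1/(m + 1). *)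
Lemma ln_fact_bounds n : let L := n.+1%:R * ln n.+1%:R - n.+1%:R in
  L - ln n.+1%:R <= ln (n`!%:R : R) <= L + 1.
Proof.
have step m : ln (m.+2%:R : R) = ln m.+1%:R + ln (1 + m.+1%:R^-1).
  rewrite -lnM ?posrE ?addr_gt0 ?invr_gt0 ?ltr0n//; congr ln.
  by rewrite mulrDr mulr1 divff ?pnatr_eq0// natr1.
have up m : ln (1 + m.+1%:R^-1) <= m.+1%:R^-1 :> R.
  by rewrite le_ln1Dx// (@lt_le_trans _ _ 0)// invr_ge0.
have lo m : m.+2%:R^-1 <= ln (1 + m.+1%:R^-1) :> R.
  have := @le_ln1Dx R (- m.+2%:R^-1).
  have m2 : m.+2%:R^-1 < 1 :> R by rewrite invf_lt1 ?ltr0n// ltr1n.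
  rewrite ltrN2 => /(_ m2); rewrite lerNr -lnV ?posrE ?subr_gt0//.
  congr (_ <= ln _); rewrite -[m.+2%:R]natr1; field.
  by rewrite [1 + _]addrC !natr1 !pnatr_eq0.
elim: n => [|n /=]; first by rewrite fact0 ln1 /=; apply/andP; split; lra.
rewrite factS natrM lnM ?posrE ?ltr0n ?fact_gt0// step => /andP[h1 h2].
have := up n; have := lo n.
set l := ln (1 + _); set a := ln n.+1%:R in h1 h2 *.
have n1 : 0 < n.+1%:R :> R by rewrite ltr0n.
have n2 : 0 < n.+2%:R :> R by rewrite ltr0n.
rewrite -[_^-1 in X in X -> _]mul1r ler_pdivrMr// => lo'.
rewrite -[_^-1 in X in X -> _]mul1r ler_pdivlMr// => up'.
rewrite -[n.+2%:R]natr1 in lo' *.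
by apply/andP; split; move: (h1) (h2) (lo') (up'); clear; nra.
Qed.

Lemma cvg_ln_fact :
  (ln (n.-1`!%:R : R) - n.-1%:R * ln n%:R) / n%:R @[n --> \oo] --> (-1 : R).
Proof.
apply/cvgrPdist_lt => e e0; near=> n.
have n0 : (0 < n)%N by near: n; exact: nbhs_infty_gt.
have : `|ln (e / 2)| / (e / 2) < n%:R by near: n; exact: nbhs_infty_gtr.
rewrite ltr_pdivrMr ?divr_gt0// => en.
have [m nm] : exists m, n = m.+1 by exists n.-1; rewrite prednK.
rewrite nm in en *.
have n1 : 0 < m.+1%:R :> R by rewrite ltr0n.
have /andP[h1 h2] := ln_fact_bounds m.
(* From ln z <= z - 1 at z = n e/2, so that ln n is negligible against n. *)
have lnn : ln m.+1%:R <= m.+1%:R * (e / 2) - 1 - ln (e / 2).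
  rewrite lerBrDr -lnM ?posrE ?divr_gt0//.
  have := @le_ln1Dx R (m.+1%:R * (e / 2) - 1).
  by rewrite addrCA subrr addr0; apply; rewrite ltrBrDl subrr mulr_gt0 ?divr_gt0.
have := ler_norm (- ln (e / 2)); rewrite normrN => le2.
rewrite -(ltr_pM2l n1) -[m.+1%:R in X in X * `|_|]gtr0_norm// -normrM.
set v := m.+1%:R * _.
have -> : v = - m.+1%:R - (ln m`!%:R - m%:R * ln m.+1%:R).
  by rewrite /v /=; field; rewrite gt_eqF.
rewrite ltr_norml; move: h1 h2.
have nE : m%:R = m.+1%:R - 1 :> R by rewrite -natr1 addrK.
rewrite nE mulrBl mul1r => h1 h2.
apply/andP; split; move: (h1) (h2) (lnn) (le2) (en) (n1) (e0); clear; nra.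
Unshelve. all: by end_near. Qed.

End Profile.

(** * Signatures and the limit *)

Section Signatures.

Lemma signature_le N (lam : N.-tuple int) (i j : 'I_N) :
  is_signature lam -> (i <= j)%N -> tnth lam j <= tnth lam i.
Proof.
move=> ls ij; rewrite !(tnth_nth 0).
apply: (@sorted_leq_nth _ (fun a b : int => b <= a)) => //.
- by move=> a b c h1 h2; exact: le_trans h1.
- by rewrite inE size_tuple.
- by rewrite inE size_tuple.
Qed.

Lemma signature_le_head N (lam : N.-tuple int) (i : 'I_N) :
  is_signature lam -> tnth lam i <= head 0 lam.
Proof.
case: N lam i => [lam []//|N] lam i ls.
rewrite -nth0 -[X in _ <= X](tnth_nth 0 lam ord0).
exact: signature_le.
Qed.

Lemma signature_ge_last N (lam : N.-tuple int) (i : 'I_N) :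
  is_signature lam -> last 0 lam <= tnth lam i.
Proof.
case: N lam i => [lam []//|N] lam i ls.
rewrite -nth_last size_tuple -[X in X <= _](tnth_nth 0 lam ord_max).
by apply: signature_le; rewrite //= -ltnS.
Qed.

Lemma shifted_part_inj N (lam : N.-tuple int) :
  is_signature lam -> injective (shifted_part lam).
Proof.
move=> ls.
have lt (i j : 'I_N) : (i < j)%N -> shifted_part lam j < shifted_part lam i.
  move=> ij; rewrite /shifted_part ler_ltD ?signature_le ?(ltnW ij)//.
  by rewrite ltz_nat ltn_sub2l ?ltnS// (leq_ltn_trans ij).
move=> i j ij; apply/val_inj; case: (ltngtP i j) => // h.
- by have := lt i j h; rewrite ij ltxx.
- by have := lt j i h; rewrite ij ltxx.
Qed.

End Signatures.

Section Assembly.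
Context {R : realType}.
Local Notation mu := (@lebesgue_measure R).

Lemma hypo_image N (a : 'I_N -> R) (t : R) : injective a ->
  hypo [seq a i | i <- enum 'I_N] t =
  \sum_(k < N) expR (t * a k) / \prod_(j < N | j != k) (a k - a j).
Proof.
move=> aI; rewrite /hypo big_map big_enum; apply: eq_bigr => k _.
congr (_ / _); rewrite big_map big_enum_cond; apply: eq_bigl => j.
by rewrite (inj_eq aI).
Qed.

(* Applied with [s] the sign of [y], which makes [s * y] positive. *)
Lemma normalized_schur_hypo n (lam : n.+1.-tuple int) (y s : R)
    (X := fun i => s * ((shifted_part lam i)%:~R / n.+1%:R)) :
  is_signature lam -> y != 0 -> s * s = 1 -> s * (expR y - 1) = `|expR y - 1| ->
  normalized_schur lam (expR y) = n`!%:R / `|expR y - 1| ^+ n / n.+1%:R ^+ n *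
    hypo [seq X i | i <- enum 'I_n.+1] (n.+1%:R * (s * y)).
Proof.
move=> ls y0 ss sy.
have s0 : s != 0 by apply: contra_eqN ss => /eqP ->; rewrite mul0r eq_sym oner_eq0.
have N0 : n.+1%:R != 0 :> R by rewrite pnatr_eq0.
have LI : injective (fun i => (shifted_part lam i)%:~R : R).
  by move=> i j /intr_inj; exact: shifted_part_inj.
have XI : injective X.
  by move=> i j /(mulfI s0) /(mulIf (invr_neq0 N0)); exact: LI.
have e1 : expR y != 1 by rewrite -(expR0 R) (inj_eq (@expR_inj R)).
rewrite normalized_schurE//; last by rewrite gt_eqF ?expR_gt0.
rewrite hypo_image// -sy !mulr_sumr; apply: eq_bigr => k _.
rewrite expR_exprz exprMn.
have -> : n.+1%:R * (s * y) * X k = y * (shifted_part lam k)%:~R.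
  transitivity (s * s * (y * (shifted_part lam k)%:~R)); last by rewrite ss mul1r.
  by rewrite /X; field.
have -> : \prod_(j < n.+1 | j != k) (X k - X j) = s ^+ n / n.+1%:R ^+ n *
    \prod_(j < n.+1 | j != k)
      ((shifted_part lam k)%:~R - (shifted_part lam j)%:~R).
  have cardk : #|[pred j : 'I_n.+1 | j != k]| = n.
    by have := cardC1 k; rewrite card_ord.
  rewrite -expr_div_n -[X in _ ^+ X]cardk -prodr_const -big_split /=.
  by apply: eq_bigr => j _; rewrite /X; field.
have sn : s ^+ n * s ^+ n = 1 by rewrite -exprMn ss expr1n.
have P0 : \prod_(j < n.+1 | j != k)
    ((shifted_part lam k)%:~R - (shifted_part lam j)%:~R) != 0 :> R.
  by apply/prodf_neq0 => j jk; rewrite subr_eq0 (inj_eq LI) eq_sym.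
have e0 : expR y - 1 != 0 by rewrite subr_eq0.
set P := \prod_(_ < _ | _) _ in P0 *.
set e := expR y - 1 in e0 *.
set E := expR _.
have := expf_neq0 n s0; move: (s ^+ n) sn => q qq q0.
rewrite -[LHS]divr1 -[X in _ / X]qq; field.
by rewrite ?P0 ?N0 ?q0 ?expf_neq0.
Qed.

Lemma Rinfty_dev N (lam : N.-tuple int) (f : R -> R) (i : 'I_N) :
  profile_dev lam f i <= Rinfty lam f.
Proof. by rewrite /Rinfty; apply: le_bigmax. Qed.

Lemma fhat_nonincreasing (f : R -> R) :
  {in `[0, 1] &, nonincreasing_fun f} ->
  {in `[0, 1] &, nonincreasing_fun (fhat f)}.
Proof.
by move=> fd t u t0 u0 tu; rewrite /fhat lerB// lerD2r; exact: fd.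
Qed.

(** The shift 1 - i/N is common to the node and to [fhat], and cancels. *)
Lemma shifted_part_dev N (lam : N.-tuple int) (f : R -> R) (i : 'I_N) :
  `|(shifted_part lam i)%:~R / N%:R - fhat f (i.+1%:R / N%:R)| =
  profile_dev lam f i.
Proof.
have N0 : N%:R != 0 :> R by rewrite pnatr_eq0 -lt0n (leq_ltn_trans _ (ltn_ord i)).
rewrite /profile_dev /fhat /shifted_part rmorphD /= -pmulrn natrB//.
by congr (`|_|); field.
Qed.

(** Contradicts the decay of [R1] over [N]; this is how [w0] is kept from lying on the wrong side of
    the excluded interval. *)
Lemma R1_ge N (lam : N.-tuple int) (f : R -> R) : (0 < N)%N ->
  (forall i, 1 <= profile_dev lam f i) -> 1 <= R1 lam f / N%:R.
Proof.
move=> N0 h; rewrite ler_pdivlMr ?ltr0n// mul1r.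
rewrite -[X in X%:R <= _](card_ord N) -sum1_card natr_sum /R1.
exact: ler_sum.
Qed.

End Assembly.

Theorem proposition4p1 (R : realType)
    (lam : forall N : nat, N.-tuple int) (f : R -> R) (y w0 : R)
    (lam_sig : forall N, is_signature (lam N))
    (f_dec : {in `[0, 1] &, nonincreasing_fun f})
    (f_pc : piecewise_continuous 0 1 f)
    (Rinfty_bounded : exists M : R, forall N, Rinfty (lam N) f <= M)
    (R1_small : R1 (lam N) f / N%:R @[N --> \oo] --> (0 : R))
    (y_neq0 : y != 0)
    (w0_root : \int[lebesgue_measure]_(t in `[0, 1]) (w0 - fhat f t)^-1 = y)
    (w0_pos : 0 < y -> fhat f 0 < w0)
    (w0_neg : y < 0 -> w0 < fhat f 1)
    (w0_out : \forall N \near \oo,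
       w0 \notin `[(last 0 (lam N))%:~R / N%:R,
                   (head 0 (lam N))%:~R / N%:R + 1]) :
  ln (normalized_schur (lam N) (expR y)) / N%:R @[N --> \oo] -->
    y * w0 - logpot f w0 - 1 - ln `|expR y - 1|.

Proof.
have f01 := fhat_nonincreasing f f_dec.
have in0 : (0 : R) \in `[0, 1] by rewrite in_itv /= lexx ler01.
have in1 : (1 : R) \in `[0, 1] by rewrite in_itv /= lexx ler01.
have fb t : t \in `[0, 1] -> fhat f 1 <= fhat f t <= fhat f 0.
  move=> t01; have := t01; rewrite in_itv /= => /andP[t0 t1].
  by rewrite !f01.
pose s : R := Num.sg y.
have ss : s * s = 1 by rewrite -expr2 sqr_sg y_neq0.
have sy : 0 < s * y by rewrite -normrEsg normr_gt0.
(* For negative [y] the root lies below the profile; multiplication by [s] places it above in both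
   cases, at the price of a profile that increases when [y < 0]. *)
pose phi (t : R) := s * fhat f t.
have sE : (s = 1 /\ 0 < y) \/ (s = -1 /\ y < 0).
  have [yp|yn|y0] := ltgtP 0 y; last by rewrite -y0 eqxx in y_neq0.
    by left; rewrite /s gtr0_sg.
  by right; rewrite /s ltr0_sg.
have pm : monotone01 phi.
  case: sE => -[sE _]; [right|left] => t u t0 u0 tu; rewrite /phi sE.
    by rewrite !mul1r f01.
  by rewrite !mulN1r lerN2 f01.
have pw t : t \in `[0, 1] -> phi t < s * w0.
  move=> /fb /andP[f1 f0]; rewrite /phi.
  case: sE => -[-> /[dup] yy]; rewrite ?mul1r ?mulN1r ?ltrN2.
    by move/w0_pos; exact: le_lt_trans.
  by move/w0_neg => /lt_le_trans; exact.
have pdom t : t \in `[0, 1] -> s * w0 - phi t = `|w0 - fhat f t|.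
  move=> /[dup] t01 /pw; rewrite /phi -subr_gt0 -mulrBr => h.
  rewrite -[LHS]gtr0_norm// normrM.
  by case: sE => -[-> _]; rewrite ?normrN normr1 mul1r.
pose X N (i : 'I_N) : R := s * ((shifted_part (lam N) i)%:~R / N%:R).
have XI N : injective (X N).
  move=> i j /(mulfI _) h; have N0 : (0 < N)%N by exact: leq_ltn_trans (ltn_ord i).
  have s0 : s != 0 by rewrite sgr_eq0.
  have NV : N%:R^-1 != 0 :> R by rewrite invr_eq0 pnatr_eq0 -lt0n.
  by have /(mulIf NV) /intr_inj := h s0; exact: shifted_part_inj.
have grid N (i : 'I_N) : (i.+1%:R / N%:R : R) \in `[0, 1].
  have N0 : (0 < N)%N by exact: leq_ltn_trans (ltn_ord i).
  by rewrite in_itv /= divr_ge0//= ler_pdivrMr ?ltr0n// mul1r ler_nat.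
have XE N i : `|X N i - phi (i.+1%:R / N%:R)| = profile_dev (lam N) f i.
  rewrite /X /phi -mulrBr normrM normr_sg y_neq0 mul1r.
  exact: shifted_part_dev.
have Xlow : exists K, forall N i, K <= X N i.
  have [M RM] := Rinfty_bounded.
  exists (Num.min (phi 0) (phi 1) - M) => N i.
  have := le_trans (Rinfty_dev N (lam N) f i) (RM N); rewrite -XE.
  rewrite ler_norml => /andP[h _].
  have : Num.min (phi 0) (phi 1) <= phi (i.+1%:R / N%:R).
    have := grid N i; have := grid N i; rewrite {1}in_itv /= => /andP[g0 g1] g.
    rewrite ge_min; case: pm => m.
      by rewrite (m _ _ in0 g g0).
    by rewrite (m _ _ g in1 g1) orbT.
  by move: h; set a := Num.min _ _; set b := phi _; set c := X _ _; lra.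
(* If [y > 0] and [w0] were below the interval, then every lambda_j/N would exceed w0 > f(0) + 1 >=
   f(j/N) + 1, making all deviations at least 1. The case [y < 0] is symmetric, with w0 < f(1). On
   the correct side all nodes are beyond [w0] as required. *)
have Xup : \forall N \near \oo, forall i, X N i < s * w0.
  near=> N => i.
  have N0 : (0 < N)%N by exact: leq_ltn_trans (ltn_ord i).
  have NR : 0 < N%:R^-1 :> R by rewrite invr_gt0 ltr0n.
  have : R1 (lam N) f / N%:R < 1.
    by near: N; apply: (cvgr_lt (0 : R) R1_small).
  have : w0 \notin `[(last 0 (lam N))%:~R / N%:R,
                   (head 0 (lam N))%:~R / N%:R + 1] by near: N.
  rewrite in_itv /= negb_and -!ltNge => wout.
  rewrite ltNge => /negP R1N.
  have lo (j : 'I_N) : (last 0 (lam N))%:~R / N%:R <= (tnth (lam N) j)%:~R / N%:R :> R.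
    by rewrite ler_pM2r// ler_int signature_ge_last.
  have hi (j : 'I_N) : (tnth (lam N) j)%:~R / N%:R <= (head 0 (lam N))%:~R / N%:R :> R.
    by rewrite ler_pM2r// ler_int signature_le_head.
  have E : (shifted_part (lam N) i)%:~R / N%:R =
      (tnth (lam N) i)%:~R / N%:R + 1 - i.+1%:R / N%:R :> R.
    rewrite /shifted_part rmorphD /= -pmulrn natrB//; field.
    by rewrite pnatr_eq0 -lt0n.
  have i0 : 0 < i.+1%:R / N%:R :> R by rewrite mulr_gt0.
  have i1 : i.+1%:R / N%:R <= 1 :> R by have := grid N i; rewrite in_itv => /andP[].
  have := lo i; have := hi i; rewrite /X E.
  have fr (j : 'I_N) : f 1 <= f (j.+1%:R / N%:R) <= f 0.
    have := grid N j; have := grid N j; rewrite {1}in_itv /= => /andP[g0 g1] g.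
    by rewrite !f_dec.
  case: sE => -[-> ys]; rewrite ?mul1r ?mulN1r ?ltrN2 => hi' lo'.
    case/orP: wout => [wl|wh].
      exfalso; apply: R1N; apply: R1_ge => // j; rewrite /profile_dev.
      apply: le_trans (ler_norm _).
      have := lo j; have /andP[_] := fr j; have := w0_pos ys; rewrite /fhat.
      by move: (wl); clear; lra.
    by move: (wh) (hi') (i0); clear; lra.
  case/orP: wout => [wl|wh].
    by move: (wl) (lo') (i1); clear; lra.
  exfalso; apply: R1N; apply: R1_ge => // j; rewrite /profile_dev.
  rewrite distrC; apply: le_trans (ler_norm _).
  have := hi j; have /andP[+ _] := fr j; have := w0_neg ys; rewrite /fhat.
  by move: (wh); clear; lra.
have intE : \int[lebesgue_measure]_(t in `[0, 1]) (s * w0 - phi t)^-1 = s * y.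
  rewrite -w0_root -RintegralZl//.
    apply: eq_Rintegral => t; rewrite inE /= => t01; rewrite /phi -mulrBr invfM.
    by case: sE => -[-> _]; rewrite ?invrN invr1.
  have : monotone01 (fun t => (w0 - fhat f t)^-1).
    have := monotone01_inv phi (s * w0) pm pw.
    case: sE => -[sE _]; rewrite /phi sE.
      by case=> m; [left|right] => t u t0 u0 tu; have := m t u t0 u0 tu;
        rewrite !mul1r.
    case=> m; [right|left] => t u t0 u0 tu; have := m t u t0 u0 tu;
      by rewrite !mulN1r -!opprD !invrN lerN2.
  by move/monotone01_integrable.
have X0 : (\sum_(i < N) `|X N i - phi (i.+1%:R / N%:R)|) / N%:R @[N --> \oo] --> (0 : R).
  move: R1_small; apply: cvg_trans; apply: near_eq_cvg; apply: nearW => N.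
  by congr (_ / _); apply: eq_bigr => i _; rewrite XE.
have main := hypo_profile_asymptotic phi X (s * y) (s * w0) sy pm pw intE XI
  Xlow Xup X0.
have logE : \int[lebesgue_measure]_(t in `[0, 1]) ln (s * w0 - phi t) = logpot f w0.
  by apply: eq_Rintegral => t; rewrite inE /= => t01; rewrite pdom.
have swE : s * y * (s * w0) = y * w0 by rewrite mulrACA ss mul1r.
rewrite logE swE in main.
have invN : (N%:R^-1 : R) @[N --> \oo] --> (0 : R).
  apply/cvgrPdist_lt => e e0; near=> N.
  have N0 : (0 < N)%N by near: N; exact: nbhs_infty_gt.
  rewrite sub0r normrN gtr0_norm ?invr_gt0 ?ltr0n// -[e]invrK.
  rewrite ltf_pV2 ?posrE ?invr_gt0 ?ltr0n//.
  by near: N; exact: nbhs_infty_gtr.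
pose c := ln `|expR y - 1|.
(* The three contributions are the divided difference, the factorial combined with the power N^(N-1)
   from rescaling the nodes, and the power N - 1 of |e^y - 1|, whence the factor 1 - 1/N. *)
have : ln (hypo [seq X N i | i <- enum 'I_N] (N%:R * (s * y))) / N%:R +
    (ln (N.-1`!%:R : R) - N.-1%:R * ln N%:R) / N%:R - (1 - N%:R^-1) * c
    @[N --> \oo] --> y * w0 - logpot f w0 + (-1) - (1 - 0) * c.
  apply: cvgB; first by apply: cvgD main _; exact: cvg_ln_fact.
  by apply: cvgM; [apply: cvgB => //; exact: cvg_cst|exact: cvg_cst].
rewrite subr0 mul1r; apply: cvg_trans; apply: near_eq_cvg; near=> N.
have N0 : (0 < N)%N by near: N; exact: nbhs_infty_gt.
have : exists n, N = n.+1 by exists N.-1; rewrite prednK.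
case=> n ->.
have e1 : expR y != 1 by rewrite -(expR0 R) (inj_eq (@expR_inj R)).
have es : s * (expR y - 1) = `|expR y - 1|.
  case: sE => -[-> yy]; first by rewrite mul1r gtr0_norm// subr_gt0 expR_gt1.
  by rewrite mulN1r ltr0_norm// subr_lt0 expR_lt1.
rewrite (normalized_schur_hypo n (lam n.+1) y s)// -/(X n.+1).
have h0 : 0 < hypo [seq X n.+1 i | i <- enum 'I_n.+1] (n.+1%:R * (s * y)).
  apply: hypo_gt0; last by rewrite mulr_gt0.
  - by rewrite map_inj_uniq ?enum_uniq//; exact: XI.
  - by rewrite -size_eq0 size_map size_enum_ord.
have a0 : 0 < `|expR y - 1| by rewrite normr_gt0 subr_eq0.
have n0 : 0 < n`!%:R :> R by rewrite ltr0n fact_gt0.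
have nn0 : 0 < n.+1%:R :> R by rewrite ltr0n.
rewrite lnM ?posrE ?divr_gt0 ?exprn_gt0// ln_div ?posrE ?divr_gt0 ?exprn_gt0//.
rewrite ln_div ?posrE ?exprn_gt0// !lnXn// -/c -[ln _ *+ n]mulr_natl -[c *+ n]mulr_natl.
have -> : n%:R = n.+1%:R - 1 :> R by rewrite -natr1 addrK.
by field; rewrite gt_eqF.
Unshelve. all: by end_near. Qed.
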